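(* Let $X$ be a Banach space with a conditional spreading basis $(e_i)_i$ and let $(z_i)_i$ be its convex block homogeneous part. Every sequence in $X$ that is equivalent to $(z_i)_i$ has a subsequence whose closed linear span is a complemented subspace of $X$.
   Context: Banach spaces are real. Two sequences are equivalent if the norms of their finite linear combinations with the same coefficients are comparable up to uniform positive constants. A sequence is spreading (resp. 1-spreading) if it is equivalent (resp. isometrically equivalent) to all of its subsequences. A conditional spreading basis is a Schauder basis that is spreading and not unconditional. A convex block sequence of $(x_i)_i$ is a sequence $(w_k)_k$ with $w_k=\sum_{i\in F_k}c_ix_i$, where $F_1<F_2<\cdots$ are successive finite subsets of $\mathbb{N}$, $c_i\geqslant0$ and $\sum_{i\in F_k}c_i=1$. Convex block homogeneous part: let $(e_i)_i$ be a conditional spreading basis of $X$. After passing to an equivalent norm on $X$ with respect to which $(e_i)_i$ is 1-spreading (such a norm exists), let $Z$ be the completion of $c_{00}(\mathbb{N})$, with unit vector basis denoted $(z_i)_i$, under the norm $$\Big\|\sum_{i=1}^na_iz_i\Big\|=\lim_{N\to\infty}\Big\|\sum_{i=1}^na_i\Big(\frac1N\sum_{j=(i-1)N+1}^{iN}e_j\Big)\Big\|=\inf\Big\{\Big\|\sum_{i=1}^na_iw_i\Big\|:(w_i)_{i=1}^n\text{ is a convex block sequence of }(e_i)_i\Big\}.$$ The sequence $(z_i)_i$, which is well defined up to equivalence, is the convex block homogeneous part of $(e_i)_i$. *)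

(* Defs.v *)
From HB Require Import structures.
From mathcomp Require Import all_boot all_order all_algebra.
From mathcomp Require Import all_classical all_reals all_analysis.

Set Implicit Arguments.
Unset Strict Implicit.
Unset Printing Implicit Defensive.

Import Order.TTheory GRing.Theory Num.Theory.
Import numFieldNormedType.Exports.

Local Open Scope classical_set_scope.
Local Open Scope ring_scope.

(* All sequences are indexed from 0. A subsequence of x is x \o f with
   increasing_seq f. *)

Section Sequences.
Context {R : realType}.

Definition equivalent_seq {X Y : normedModType R} (x : nat -> X) (y : nat -> Y)
    : Prop :=
  exists c C : R, [/\ 0 < c, 0 < C &
    forall (n : nat) (a : nat -> R),
      c * `|\sum_(i < n) a i *: x i| <= `|\sum_(i < n) a i *: y i|
        <= C * `|\sum_(i < n) a i *: x i|].

Definition spreading {X : normedModType R} (x : nat -> X) : Prop :=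
  forall f : nat -> nat, increasing_seq f -> equivalent_seq x (x \o f).

Definition closed_span {X : normedModType R} (x : nat -> X) : set X :=
  closure [set v | exists (n : nat) (a : nat -> R),
                     v = \sum_(i < n) a i *: x i].

Definition schauder_basis {X : normedModType R} (e : nat -> X) : Prop :=
  forall x : X, exists! a : nat -> R,
    series (fun i => a i *: e i) @ \oo --> x.

(* Every basis expansion converges unconditionally, i.e. along every
   rearrangement of its terms. *)
Definition unconditional_basis {X : normedModType R} (e : nat -> X) : Prop :=
  schauder_basis e /\
  forall (a : nat -> R) (s : nat -> nat), bijective s ->
    cvgn (series (fun i => a i *: e i)) ->
    cvgn (series (fun i => a (s i) *: e (s i))).

Definition conditional_spreading_basis {X : normedModType R} (e : nat -> X)
    : Prop :=
  [/\ schauder_basis e, spreading e & ~ unconditional_basis e].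

(* Definiteness of nrm follows from the last clause. *)
Definition equivalent_norm {X : normedModType R} (nrm : X -> R) : Prop :=
  [/\ forall x y : X, nrm (x + y) <= nrm x + nrm y,
      forall (a : R) (x : X), nrm (a *: x) = `|a| * nrm x &
      exists c C : R, [/\ 0 < c, 0 < C &
        forall x : X, c * `|x| <= nrm x <= C * `|x|]].

Definition one_spreading {X : normedModType R} (nrm : X -> R) (x : nat -> X)
    : Prop :=
  forall f : nat -> nat, increasing_seq f ->
    forall (n : nat) (a : nat -> R),
      nrm (\sum_(i < n) a i *: x (f i)) = nrm (\sum_(i < n) a i *: x i).

(* The i-th average of length N; the value at N = 0 is irrelevant, as only
   the limit N -> oo is used. *)
Definition block_average {X : normedModType R} (e : nat -> X) (N i : nat) : X :=
  N%:R^-1 *: \sum_((i * N)%N <= j < (i.+1 * N)%N) e j.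

(* Z, with its distinguished sequence z, is the completion of c00 for the
   norm given by the limit below: a Banach space in which z has dense span
   and whose norm on finite linear combinations of z is that limit (which
   always exists, and equals the infimum of nrm (\sum_(i < n) a i *: w i) over
   the convex block sequences w of e). As nrm is existentially quantified, z
   may come from any admissible renorming of X. *)
Definition convex_block_homogeneous_part {X : normedModType R}
    {Z : completeNormedModType R} (e : nat -> X) (z : nat -> Z) : Prop :=
  exists nrm : X -> R,
    [/\ equivalent_norm nrm,
        one_spreading nrm e,
        closed_span z = [set: Z] &
        forall (n : nat) (a : nat -> R),
          (fun N => nrm (\sum_(i < n) a i *: block_average e N i)) @ \oo -->
            `|\sum_(i < n) a i *: z i|].

Definition complemented {X : normedModType R} (Y : set X) : Prop :=
  exists P : {linear X -> X},
    [/\ continuous P, forall x : X, P (P x) = P x & range P = Y].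

End Sequences.

(* Main.v *)
Require Import Defs.
From HB Require Import structures.
From mathcomp Require Import all_boot all_order all_algebra.
From mathcomp Require Import all_classical all_reals all_analysis.
From mathcomp Require Import ring lra zify.

(* Let S n and B n be the partial sums of the coefficients b_i, resp. of the
   terms b_i e_i, of a coordinatewise cluster point b of the sequence y. Up to
   a subsequence y_k = B (n k) + w_k up to a small error, with w_k supported on
   [n k, n (k+1)) and with coefficient sums of y_k tending to some sigma.
   If S has a cluster point beta <> sigma, choose the cuts n k with
   S (n k) --> beta. The map sending every e_i of the k-th block to y_k is
   bounded, because averaging spread copies shows that e dominates every
   sequence z_{k(i)} with k nondecreasing; it sends y_k to almost
   (sigma - beta) y_k, so a small perturbation of a multiple of it is a
   projection.
   Otherwise S --> sigma, so that the w_k have coefficient sum almost 0. As e is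
   conditional, it is not an l1-basis and the e_{2k} - e_{2k+1} have small
   convex combinations. Passing to convex blocks of y therefore removes the w_k,
   and z is dominated by the summing basis of c0. If z_0 <> z_1 then B is not
   Cauchy; norming functionals of the blocks B (n (2j+2)) - B (n (2j+1)) then
   give a bounded projection, as in Sobczyk's theorem. If z_0 = z_1 then y is
   constant. *)

(** The sums [B n] are bounded but may diverge, since the basis need not be boundedly complete; so
    [y] cannot be turned into a block sequence by subtracting a limit, and the operator has to treat
    [B (n k)] and [w_k] separately. What makes this possible when z_0 <> z_1 is that tail sums of
    coefficients are bounded functionals, for [e] and for every subsequence of [y]. For [e] this
    bounds the price of suppressing a block, which is proportional to its coefficient sum. For [y]
    it tames the defect y_k - T y_k, which contains the errors of all earlier cuts and need not tend
    to 0: after summation by parts these errors are multiplied by tail sums only. In the first case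
    the image of [B (n k)] is a sum of terms (S (n (j+1)) - S (n j)) y_j, which are summably small
    because every S (n j) is close to beta, while [w_k] has coefficient sum about sigma - beta. In
    the second case the same choice would give [w_k] a factor close to 0, so there [y_k] must be
    recovered from [B (n k)] alone; domination by the summing basis is what makes that recovery
    bounded. *)

Set Implicit Arguments.
Unset Strict Implicit.
Unset Printing Implicit Defensive.

Import Order.TTheory GRing.Theory Num.Theory.
Import numFieldNormedType.Exports.

Local Open Scope classical_set_scope.
Local Open Scope ring_scope.

(** * Spreading seminorm estimates *)

(** The averaging arguments compare N spread copies with N times a vector, up to an error
    independent of [N]; division by [N] makes that error vanish in the limit. *)
Lemma le_of_cvg_harmonic (R : realType) (u : nat -> R) (l D E : R) :
  u @ \oo --> l ->
  (forall N, (0 < N)%N -> u N <= D + E / N%:R) -> l <= D.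
Proof.
move=> ul uDE; apply/ler_addgt0Pr => eps eps0.
apply: (ler_cvg_to ul (cvg_cst (D + eps))).
near=> N.
have N0 : (0 < N)%N by near: N; exact: nbhs_infty_gt.
apply: (le_trans (uDE _ N0)); rewrite lerD2l ler_pdivrMr ?ltr0n//.
rewrite mulrC -ler_pdivrMr//; near: N; exact: nbhs_infty_ger.
Unshelve. all: by end_near. Qed.

Lemma increasing_seq_lt (f : nat -> nat) :
  {homo f : n m / (n < m)%N} -> increasing_seq f.
Proof. by move=> fi; apply/increasing_seqP => n; rewrite ltEnat/=; apply: fi. Qed.

Lemma increasing_seq_ltE (f : nat -> nat) :
  increasing_seq f -> {mono f : n m / (n < m)%N}.
Proof. by move=> fi; apply: leqW_mono. Qed.

(** [k] need not be injective: terms landing on the same index are merged. An inequality valid for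
    all coefficients thus passes to repeated indices. *)
Lemma sum_reindex (R : nzRingType) (V : lmodType R) (k : nat -> nat) (n m : nat)
    (a : nat -> R) (g : nat -> V) :
  (forall i, (i < n)%N -> (k i < m)%N) ->
  \sum_(j < m) (\sum_(i < n | k i == j) a i) *: g j =
  \sum_(i < n) a i *: g (k i).
Proof.
move=> km; under eq_bigr do rewrite scaler_suml.
rewrite (exchange_big_dep predT)//=; apply: eq_bigr => i _.
by rewrite (big_pred1 (Ordinal (km i (ltn_ord i))))//= => j; rewrite -val_eqE/= eq_sym.
Qed.

Definition window (V : nmodType) (e : nat -> V) (N q : nat) : V :=
  \sum_(0 <= t < N) e (q + t).

Section EquivalentNorm.
Context (R : realType) (X : normedModType R) (nrm : X -> R).
Context (nrmE : equivalent_norm nrm).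

Let nrmD x y : nrm (x + y) <= nrm x + nrm y. Proof. by case: nrmE. Qed.

Let nrmZ (a : R) x : nrm (a *: x) = `|a| * nrm x. Proof. by case: nrmE. Qed.

Lemma eqnorm_ge0 x : 0 <= nrm x.
Proof.
case: nrmE => _ _ [c [C [c0 _ H]]].
by apply: le_trans (proj1 (andP (H x))); rewrite mulr_ge0// ltW.
Qed.

Lemma eqnormN x : nrm (- x) = nrm x.
Proof. by rewrite -scaleN1r nrmZ normrN normr1 mul1r. Qed.

Lemma eqnormB x y : nrm (x - y) <= nrm x + nrm y.
Proof. by apply: le_trans (nrmD _ _) _; rewrite eqnormN. Qed.

Lemma eqnorm_le_add x y : nrm x <= nrm y + nrm (x - y).
Proof. by rewrite -{1}(subrKC y x). Qed.

Lemma eqnorm_sum (I : Type) (r : seq I) (P : pred I) (F : I -> X) :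
  nrm (\sum_(i <- r | P i) F i) <= \sum_(i <- r | P i) nrm (F i).
Proof.
elim/big_ind2 : _ => //; first by rewrite -(scale0r 0) nrmZ normr0 mul0r.
by move=> x1 x2 y1 y2 h1 h2; apply: le_trans (nrmD _ _) _; apply: lerD.
Qed.

Section OneSpreading.
Context (e : nat -> X) (spr : one_spreading nrm e).

Lemma eqnorm_spreading (f : nat -> nat) n (a : nat -> R) :
  {homo f : i j / (i < j)%N} ->
  nrm (\sum_(0 <= i < n) a i *: e (f i)) = nrm (\sum_(0 <= i < n) a i *: e i).
Proof. by move=> /increasing_seq_lt fi; rewrite !big_mkord; apply: spr. Qed.

Lemma eqnorm_basis i : nrm (e i) = nrm (e 0%N).
Proof.
have := @eqnorm_spreading (addn i) 1 (fun=> 1) (fun _ _ => _).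
by rewrite !big_nat1 addn0 !scale1r; apply => j k; rewrite ltn_add2l.
Qed.

Lemma eqnorm_window N q : nrm (window e N q) <= N%:R * nrm (e 0%N).
Proof.
apply: le_trans (eqnorm_sum _ _ _) _.
under eq_bigr do rewrite eqnorm_basis.
by rewrite big_const_nat subn0 iter_addr_0 mulr_natl.
Qed.

(** Moving a window by one step exchanges a single vector, so the cost does not depend on the length
    [N]. *)
Lemma eqnorm_window_shift N q r :
  nrm (window e N (q + r) - window e N q) <= (r * 2)%:R * nrm (e 0%N).
Proof.
elim: r => [|r IH].
  by rewrite addn0 subrr -(scale0r 0) nrmZ normr0 mul0r mulr_ge0// eqnorm_ge0.
have -> : window e N (q + r.+1) = window e N (q + r) + (e (q + r + N) - e (q + r)).
  apply/(addrI (e (q + r))); rewrite [RHS]addrCA subrKC.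
  rewrite /window -[X in e X + _ = _]addn0 -big_nat_recr//=.
  rewrite [RHS]big_nat_recl//=; congr (_ + _).
  by apply: eq_bigr => i _; congr e; lia.
rewrite addrAC; apply: le_trans (nrmD _ _) _.
rewrite mulSn [(2 + _)%N]addnC natrD mulrDl; apply: lerD => //.
by apply: le_trans (eqnormB _ _) _; rewrite !eqnorm_basis mulrDl mul1r.
Qed.


Lemma eqnorm_average_spread N n (a : nat -> R) (f : nat -> nat -> nat) :
  (forall t, (t < N)%N -> {homo f t : i j / (i < j)%N}) ->
  nrm (\sum_(0 <= t < N) \sum_(0 <= i < n) a i *: e (f t i)) <=
  N%:R * nrm (\sum_(0 <= i < n) a i *: e i).
Proof.
move=> fi; apply: le_trans (eqnorm_sum _ _ _) _.
rewrite (eq_big_nat _ _ (F2 := fun=> nrm (\sum_(0 <= i < n) a i *: e i))).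
  by rewrite big_const_nat subn0 iter_addr_0 mulr_natl.
by move=> t tN; apply: eqnorm_spreading; apply: fi.
Qed.

Lemma eqnorm_sum_window (a : nat -> R) p q (g h : nat -> nat) : exists E : R,
  forall N, nrm (\sum_(p <= i < q) a i *: window e N (g i + h i) -
                 \sum_(p <= i < q) a i *: window e N (g i)) <= E.
Proof.
exists (\sum_(p <= i < q) `|a i| * ((h i * 2)%:R * nrm (e 0%N))) => N.
rewrite -sumrB; apply: le_trans (eqnorm_sum _ _ _) _; apply: ler_sum => i _.
by rewrite -scalerBr nrmZ ler_wpM2l// eqnorm_window_shift.
Qed.

End OneSpreading.
End EquivalentNorm.

(** * Blocks together with their coefficient sums *)

Section Blocks.
Context (R : realType) (X : normedModType R) (e : nat -> X).

(** A relation, since [e] is an arbitrary sequence here and the coefficient sum [t] is not a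
    function of the vector [v]. *)
Definition block (p q : nat) (v : X) (t : R) : Prop :=
  exists2 a : nat -> R,
    v = \sum_(p <= i < q) a i *: e i & t = \sum_(p <= i < q) a i.

Lemma block0 p q : block p q 0 0.
Proof. by exists (fun=> 0); rewrite big1// => i _; rewrite scale0r. Qed.

Lemma block_sum a p q :
  block p q (\sum_(p <= i < q) a i *: e i) (\sum_(p <= i < q) a i).
Proof. by exists a. Qed.

Lemma blockZ c p q v t : block p q v t -> block p q (c *: v) (c * t).
Proof.
move=> [a -> ->]; exists (fun i => c * a i); rewrite ?mulr_sumr//.
by rewrite scaler_sumr; apply: eq_bigr => i _; rewrite scalerA.
Qed.

Lemma blockD p q u v s t :
  block p q u s -> block p q v t -> block p q (u + v) (s + t).
Proof.
move=> [a -> ->] [b -> ->]; exists (fun i => a i + b i); rewrite ?big_split//.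
by rewrite -big_split; apply: eq_bigr => i _; rewrite scalerDl.
Qed.

Lemma blockB p q u v s t :
  block p q u s -> block p q v t -> block p q (u - v) (s - t).
Proof.
by move=> us vt; rewrite -(scaleN1r v) -(mulN1r t); apply: blockD => //; apply: blockZ.
Qed.

Lemma block_cat p q r u v s t : (p <= q <= r)%N ->
  block p q u s -> block q r v t -> block p r (u + v) (s + t).
Proof.
move=> /andP[pq qr] [a -> ->] [b -> ->].
exists (fun i => if (i < q)%N then a i else b i);
  rewrite (@big_cat_nat _ _ _ q p r)//=; congr (_ + _);
  by apply: eq_big_nat => i /andP[h1 h2]; rewrite ?h2// ltnNge h1.
Qed.

End Blocks.

(** * Suppressing blocks at the price of their coefficient sums *)

Section Suppression.
Context (R : realType) (X : normedModType R) (nrm : X -> R) (e : nat -> X).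
Context (nrmE : equivalent_norm nrm) (spr : one_spreading nrm e).

Let nrmD x y : nrm (x + y) <= nrm x + nrm y. Proof. by case: nrmE. Qed.
Let nrmZ (a : R) x : nrm (a *: x) = `|a| * nrm x. Proof. by case: nrmE. Qed.

(* The middle block, spread over a long window, averages out up to its
   coefficient sum. *)
Lemma eqnorm_drop_block p q r u v w s t s' : (p <= q <= r)%N ->
  block e 0 p u s -> block e p q v t -> block e q r w s' ->
  nrm (u + w) <= nrm (u + v + w) + `|t| * nrm (e 0%N).
Proof.
move=> /andP[pq qr] [a1 -> _] [a2 -> ->] [a3 -> _].
set u' := \sum_(0 <= i < p) _; set v' := \sum_(p <= i < q) _ *: _.
set w' := \sum_(q <= i < r) _; set t' := \sum_(p <= i < q) _.
have glue (b : nat -> R) : exists a : nat -> R, forall f : nat -> nat,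
    \sum_(0 <= i < r) a i *: e (f i) =
    \sum_(0 <= i < p) a1 i *: e (f i) + \sum_(p <= i < q) b i *: e (f i)
    + \sum_(q <= i < r) a3 i *: e (f i).
  exists (fun i => if (i < p)%N then a1 i else if (i < q)%N then b i else a3 i).
  move=> f; rewrite (@big_cat_nat _ _ _ q 0 r)//= (@big_cat_nat _ _ _ p 0 q)//=.
  congr (_ + _ + _); apply: eq_big_nat => i /andP[h1 h2].
  - by rewrite h2.
  - by rewrite ltnNge h1/= h2.
  - by rewrite ltnNge (leq_trans pq h1)/= ltnNge h1.
have [E HE] := eqnorm_sum_window nrmE spr a2 p q (fun=> p) (fun i => i - p)%N.
pose D := nrm (u' + v' + w').
apply: (@le_of_cvg_harmonic _ (fun=> nrm (u' + w')) _ _ E); first exact: cvg_cst.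
move=> N N0; pose wN := \sum_(q <= i < r) a3 i *: e (i + N)%N.
(* Copy [t] keeps the left block, slides the middle one by [t] and moves the right one by [N], past
   every position of the middle. Summed over the copies, the middle becomes a combination of
   windows, close to its coefficient sum times one window. *)
pose f t i := (if i < p then i else if i < q then i + t else i + N)%N.
have fi k : (k < N)%N -> {homo f k : i j / (i < j)%N}.
  by move=> kN i j; rewrite /f; do ![case: ifP]; lia.
have fE (b : nat -> R) k :
    \sum_(0 <= i < p) a1 i *: e (f k i) + \sum_(p <= i < q) b i *: e (f k i)
      + \sum_(q <= i < r) a3 i *: e (f k i) =
    u' + \sum_(p <= i < q) b i *: e (i + k)%N + wN.
  congr (_ + _ + _); apply: eq_big_nat => i /andP[h1 h2]; rewrite /f.
  - by rewrite h2.
  - by rewrite ltnNge h1/= h2.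
  - by rewrite ltnNge (leq_trans pq h1)/= ltnNge h1.
have uwN : nrm (u' + w') = nrm (u' + wN).
  have [a aE] := glue (fun=> 0).
  have := @eqnorm_spreading _ _ _ _ spr (f 0%N) r a (fi _ N0).
  have b0 (g : nat -> nat) : \sum_(p <= i < q) (0 : R) *: e (g i) = 0.
    by rewrite big1// => i _; rewrite scale0r.
  by rewrite aE fE (aE id) (b0 id) (b0 (addn^~ 0%N)) !addr0.
have [a aE] := glue a2.
have := @eqnorm_average_spread _ _ _ nrmE _ spr N r a f fi.
rewrite (aE id) -/u' -/v' -/w' -/D (eq_bigr _ (fun k _ => aE (f k))).
rewrite (eq_bigr _ (fun k _ => fE a2 k)) !big_split/= !sumr_const_nat subn0.
rewrite exchange_big/=; set W := \sum_(p <= i < q) _ => hW.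
have {}hW : nrm ((u' + wN) *+ N + W) <= N%:R * D by rewrite mulrnDl addrAC.
have nW : nrm W <= `|t'| * (N%:R * nrm (e 0%N)) + E.
  apply: le_trans (eqnorm_le_add nrmE _ (t' *: \sum_(0 <= t < N) e (p + t)%N)) _.
  rewrite nrmZ lerD//.
    rewrite ler_wpM2l//; exact: (eqnorm_window nrmE spr).
  rewrite /t' scaler_suml /W; apply: le_trans (HE N).
  rewrite le_eqVlt; apply/orP; left; apply/eqP; congr (nrm (_ - _)).
  by apply: eq_big_nat => i /andP[pi _]; rewrite subnKC// scaler_sumr.
have N0' : (0 : R) < N%:R by rewrite ltr0n.
rewrite uwN -(ler_pM2l N0') [leRHS]mulrDr [X in _ <= _ + X]mulrC divfK ?gt_eqF//.
have -> : N%:R * nrm (u' + wN) = nrm ((u' + wN) *+ N).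
  by rewrite -scaler_nat nrmZ ger0_norm// ltW.
have := eqnorm_le_add nrmE ((u' + wN) *+ N) ((u' + wN) *+ N + W).
rewrite opprD addrA subrr add0r eqnormN// => /le_trans; apply.
by apply: le_trans (lerD hW nW) _; rewrite mulrDr mulrCA addrA.
Qed.

(** The scaled sum is a convex combination of the full sum and the sum without [v]. *)
Lemma eqnorm_scale_block c p q r u v w s t s' : (p <= q <= r)%N ->
  block e 0 p u s -> block e p q v t -> block e q r w s' -> 0 <= c <= 1 ->
  nrm (u + c *: v + w) <= nrm (u + v + w) + `|t| * nrm (e 0%N).
Proof.
move=> pqr us vt ws /andP[c0 c1].
have -> : u + c *: v + w = c *: (u + v + w) + (1 - c) *: (u + w).
  rewrite addrAC [u + v + w]addrAC [c *: (_ + v)]scalerDr scalerBl scale1r.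
  by rewrite [RHS]addrC addrA subrK.
apply: le_trans (nrmD _ _) _; rewrite !nrmZ (ger0_norm c0) (@ger0_norm _ (1 - c)) ?subr_ge0//.
move: (eqnorm_drop_block pqr us vt ws).
have := mulr_ge0 c0 (mulr_ge0 (normr_ge0 t) (eqnorm_ge0 nrmE (e 0%N))).
set T := `|t| * _; set A := nrm (u + v + w); set B := nrm (u + w) => cT hB.
have : (1 - c) * B <= (1 - c) * (A + T) by rewrite ler_wpM2l// subr_ge0.
lra.
Qed.

Lemma eqnorm_scale_blocks (n : nat -> nat) (v : nat -> X) (t th : nat -> R) J :
  (forall j, (n j <= n j.+1)%N) -> (forall j, block e (n j) (n j.+1) (v j) (t j)) ->
  (forall j, 0 <= th j <= 1) ->
  nrm (\sum_(0 <= j < J) th j *: v j) <=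
  nrm (\sum_(0 <= j < J) v j) + (\sum_(0 <= j < J) `|t j|) * nrm (e 0%N).
Proof.
move=> nS vt th01.
have blk (J' : nat) (c : nat -> R) :
    block e 0 (n J') (\sum_(0 <= j < J') c j *: v j) (\sum_(0 <= j < J') c j * t j).
  elim: J' => [|J' IH]; first by rewrite !big_geq//; exact: block0.
  rewrite !big_nat_recr//=; apply: block_cat IH _; first by rewrite nS.
  exact: blockZ.
(* The factors are removed from right to left; [w] collects the blocks already restored. *)
suff H r w s : (n J <= r)%N -> block e (n J) r w s ->
    nrm (\sum_(0 <= j < J) th j *: v j + w) <=
    nrm (\sum_(0 <= j < J) v j + w) + (\sum_(0 <= j < J) `|t j|) * nrm (e 0%N).
  by have := H (n J) 0 0 (leqnn _) (block0 _ _ _); rewrite !addr0.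
elim: J r w s => [|J IH] r w s nr ws.
  by rewrite !big_geq// mul0r addr0.
rewrite !big_nat_recr//=.
have nJr : (n J <= n J.+1 <= r)%N by rewrite nS.
apply: le_trans (eqnorm_scale_block nJr (blk J th) (vt J) ws (th01 J)) _.
rewrite mulrDl addrA lerD2r -!addrA.
by apply: IH (block_cat nJr (vt J) ws); case/andP: nJr => /leq_trans; apply.
Qed.

End Suppression.

(** * The convex block homogeneous part *)

Lemma sum_nat_mul (V : nmodType) (F : nat -> V) n N :
  \sum_(0 <= j < n * N) F j = \sum_(0 <= i < n) \sum_(i * N <= j < i.+1 * N) F j.
Proof.
elim: n => [|n IH]; first by rewrite mul0n !big_geq.
by rewrite big_nat_recr//= -IH -big_cat_nat//= leq_mul.
Qed.

Lemma dominated_comp (R : realType) (X Y : normedModType R)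
    (x : nat -> X) (y : nat -> Y) (C : R) :
  (forall n (a : nat -> R),
    `|\sum_(i < n) a i *: x i| <= C * `|\sum_(i < n) a i *: y i|) ->
  forall (f : nat -> nat) n (a : nat -> R),
    `|\sum_(i < n) a i *: x (f i)| <= C * `|\sum_(i < n) a i *: y (f i)|.
Proof.
move=> H f n a; pose m := (\max_(i < n) f i).+1.
have fm i : (i < n)%N -> (f i < m)%N.
  by move=> ni; rewrite ltnS; apply: (leq_bigmax (Ordinal ni)).
by have := H m (fun j => \sum_(i < n | f i == j) a i); rewrite !sum_reindex.
Qed.

Section HomogeneousPart.
Context (R : realType) (X Z : normedModType R) (nrm : X -> R).
Context (e : nat -> X) (z : nat -> Z).
Context (nrmE : equivalent_norm nrm) (spr : one_spreading nrm e).
Context (zE : forall (n : nat) (a : nat -> R),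
  (fun N => nrm (\sum_(i < n) a i *: block_average e N i)) @ \oo -->
    `|\sum_(i < n) a i *: z i|).

Let nrmZ (a : R) x : nrm (a *: x) = `|a| * nrm x. Proof. by case: nrmE. Qed.

Lemma cvg_block_average (k : nat -> nat) n (a : nat -> R) :
  (fun N => nrm (\sum_(i < n) a i *: block_average e N (k i))) @ \oo -->
    `|\sum_(i < n) a i *: z (k i)|.
Proof.
pose m := (\max_(i < n) k i).+1.
have km i : (i < n)%N -> (k i < m)%N.
  by move=> ni; rewrite ltnS; apply: (leq_bigmax (Ordinal ni)).
have := @zE m (fun j => \sum_(i < n | k i == j) a i); rewrite sum_reindex//.
by under eq_fun do rewrite sum_reindex//.
Qed.

Lemma block_averageE N i : block_average e N i = N%:R^-1 *: window e N (i * N).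
Proof.
rewrite /block_average /window -{1}[(i * N)%N]add0n big_addn.
rewrite mulSn addnK; congr (_ *: _).
by apply: eq_bigr => t _; rewrite addnC.
Qed.

(* The N spread copies place the i-th term at k i * N + i + t, t < N; their
   mean has almost the coefficients of the block averages. *)
Lemma homogeneous_part_le (k : nat -> nat) n (a : nat -> R) :
  {homo k : i j / (i <= j)%N} ->
  `|\sum_(i < n) a i *: z (k i)| <= nrm (\sum_(i < n) a i *: e i).
Proof.
move=> ki; set D := nrm _.
pose M := nrm (e 0%N).
pose E := \sum_(0 <= i < n) `|a i| * ((i * 2)%:R * M).
apply: (@le_of_cvg_harmonic _
  (fun N => nrm (\sum_(i < n) a i *: block_average e N (k i))) _ _ E)
  => [|N N0]; first exact: cvg_block_average.
have N0' : (0 : R) < N%:R by rewrite ltr0n.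
rewrite -(ler_pM2l N0') [leRHS]mulrDr [X in _ <= _ + X]mulrC divfK ?gt_eqF//.
set v := \sum_(0 <= i < n) a i *: window e N (k i * N).
have -> : \sum_(i < n) a i *: block_average e N (k i) = N%:R^-1 *: v.
  rewrite scaler_sumr big_mkord; apply: eq_bigr => i _.
  by rewrite block_averageE !scalerA mulrC.
rewrite nrmZ ger0_norm ?invr_ge0 ?ler0n// mulrA divff ?gt_eqF// mul1r.
set w := \sum_(0 <= i < n) a i *: window e N (k i * N + i).
have wD : nrm w <= N%:R * D.
  have := @eqnorm_average_spread _ _ _ nrmE _ spr N n a
    (fun t i => k i * N + i + t)%N.
  rewrite exchange_big/= [X in _ <= _ * nrm X]big_mkord.
  rewrite (eq_bigr _ (fun i _ => esym (scaler_sumr _ _ _ _))); apply.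
  move=> t tN i j ij; have := leq_mul (ki i j (ltnW ij)) (leqnn N); lia.
apply: le_trans (eqnorm_le_add nrmE v w) _; apply: lerD => //.
rewrite -(eqnormN nrmE) opprB /v /w -sumrB.
apply: le_trans (eqnorm_sum nrmE _ _ _) _; apply: ler_sum => i _.
rewrite -scalerBr nrmZ ler_wpM2l//; exact: (eqnorm_window_shift nrmE spr).
Qed.

(** Apply [homogeneous_part_le] to the coefficients of the block averages, with indices
    [k (j %/ N)]. The left side is the same for every [N], and the right side tends to the norm in
    Z. *)
Lemma homogeneous_part_merge (k : nat -> nat) n (a : nat -> R) :
  {homo k : i j / (i <= j)%N} ->
  `|\sum_(i < n) a i *: z (k i)| <= `|\sum_(i < n) a i *: z i|.
Proof.
move=> ki; apply: (ler_cvg_to (cvg_cst _) (@zE n a)); near=> N.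
have N0 : (0 < N)%N by near: N; exact: nbhs_infty_gt.
have sumE (V : lmodType R) (g : nat -> nat -> V) :
    \sum_(j < n * N) (a (j %/ N)%N / N%:R) *: g (j %/ N)%N j =
    \sum_(i < n) a i *: (N%:R^-1 *: \sum_(i * N <= j < i.+1 * N) g i j).
  rewrite -(big_mkord xpredT (fun j => (a (j %/ N)%N / N%:R) *: g (j %/ N)%N j)).
  rewrite sum_nat_mul big_mkord; apply: eq_bigr => i _.
  rewrite !scaler_sumr; apply: eq_big_nat => j /andP[ij ji].
  have -> : (j %/ N)%N = i by apply/eqP; rewrite eqn_leq -ltnS ltn_divLR// ji leq_divRL.
  by rewrite scalerA.
have := @homogeneous_part_le (fun j => k (j %/ N)%N) (n * N) (fun j => a (j %/ N)%N / N%:R) _.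
rewrite (sumE _ (fun i j => z (k i))) (sumE _ (fun i j => e j)).
rewrite (eq_bigr (fun i : 'I_n => a i *: z (k i))) => [|i _]; last first.
  rewrite sumr_const_nat mulSn addnK -[z (k i) *+ N]scaler_nat.
  rewrite [N%:R^-1 *: _]scalerA mulVf ?scale1r//.
  by rewrite pnatr_eq0 -lt0n.
by apply => i j ij; apply: ki; rewrite leq_div2r.
Unshelve. all: by end_near. Qed.

Lemma homogeneous_part_spreading f n (a : nat -> R) : increasing_seq f ->
  `|\sum_(i < n) a i *: z (f i)| = `|\sum_(i < n) a i *: z i|.
Proof.
move=> fi; have fle : {homo f : i j / (i <= j)%N} by move=> i j; rewrite -leEnat fi.
apply/eqP; rewrite eq_le homogeneous_part_merge//=.
have fN j : exists i, (j <= f i)%N.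
  by exists j; elim: j => // j IH; apply: leq_ltn_trans IH _; rewrite increasing_seq_ltE.
(* [g] is a nondecreasing left inverse of [f]; merging along [g] undoes the passage to the
   subsequence. *)
pose g j := ex_minn (fN j).
have gf i : g (f i) = i.
  rewrite /g; case: ex_minnP => m im /(_ i (leqnn _)) mi.
  by apply/eqP; rewrite eqn_leq mi -fi leEnat.
have gle : {homo g : i j / (i <= j)%N}.
  move=> i j ij; rewrite /g; case: ex_minnP => m _ mmin.
  by case: ex_minnP => m' jm' _; apply/mmin/leq_trans/jm'.
pose m := (\max_(i < n) f i).+1.
have fm i : (i < n)%N -> (f i < m)%N.
  by move=> ni; rewrite ltnS; apply: (leq_bigmax (Ordinal ni)).
have := homogeneous_part_merge m (fun j => \sum_(i < n | f i == j) a i) gle.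
rewrite (sum_reindex a z fm) (sum_reindex a (z \o g) fm)/=.
by under eq_bigr do rewrite gf.
Qed.

(** Merge [z 1 - z 0 = 0] along the map sending 0 to 0 and every other index to [k]. *)
Lemma homogeneous_part_const : z 0%N = z 1%N -> forall k, z k = z 0%N.
Proof.
move=> z01 k; have := @homogeneous_part_merge (fun i => if i is 0%N then 0%N else k) 2
  (fun i => if i is 0%N then -1 else 1) _.
rewrite !big_ord_recr !big_ord0/= !add0r !scaleN1r !scale1r z01 addNr normr0.
by rewrite normr_le0 addrC subr_eq0 => H; apply/eqP; apply: H => -[|i] [|j].
Qed.

(** * Bounded tail functionals when z_0 <> z_1 *)

Section NonConstant.
Context (z01 : z 0%N != z 1%N).

Definition tail_const : R := 2 / `|z 1%N - z 0%N|.

Lemma tail_const_gt0 : 0 < tail_const.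
Proof. by rewrite divr_gt0// normr_gt0 subr_eq0 eq_sym. Qed.

(** Merge the indices below [p] to 0 and the others to 1, then subtract the merge of everything to
    0: what remains is the tail sum times [z 1 - z 0]. The two merges account for the 2 in
    [tail_const]. *)
Lemma tail_le p n (a : nat -> R) :
  `|\sum_(p <= i < n) a i| <= tail_const * `|\sum_(i < n) a i *: z i|.
Proof.
have [np|pn] := leqP n p.
  by rewrite big_geq// normr0 mulr_ge0// (ltW tail_const_gt0).
rewrite /tail_const mulrAC ler_pdivlMr ?normr_gt0 ?subr_eq0 1?eq_sym//.
set D := `|\sum_(i < n) _|.
have h0 := @homogeneous_part_merge (fun=> 0%N) n a (fun _ _ _ => leqnn _).
have h1 := @homogeneous_part_merge (fun i => (p <= i)%N) n a _.
have -> : `|\sum_(p <= i < n) a i| * `|z 1%N - z 0%N| =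
    `|\sum_(i < n) a i *: z (p <= i)%N - \sum_(i < n) a i *: z 0%N|.
  rewrite -sumrB -normrZ scaler_suml; congr `| _ |.
  rewrite -(big_mkord xpredT (fun i => a i *: z (p <= i)%N - a i *: z 0%N)).
  rewrite (@big_cat_nat _ _ _ p 0 n)//=; last exact: ltnW.
  have -> : \sum_(0 <= i < p) (a i *: z (p <= i)%N - a i *: z 0%N) = 0.
    by rewrite big_nat big1// => i /andP[_ ip]; rewrite leqNgt ip/= subrr.
  rewrite add0r; apply: eq_big_nat => i /andP[pi _].
  by rewrite -scalerBr pi.
apply: le_trans (ler_normB _ _) _; rewrite -/D mulr_natl mulr2n.
apply: lerD => //; apply: h1 => i j ij.
by case: (leqP p i) => // pi; rewrite (leq_trans pi ij).
Qed.

Lemma eqnorm_tail_le p n (a : nat -> R) :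
  `|\sum_(p <= i < n) a i| <= tail_const * nrm (\sum_(i < n) a i *: e i).
Proof.
apply: le_trans (tail_le _ _ _) _; apply: ler_wpM2l; first exact: (ltW tail_const_gt0).
by apply: (@homogeneous_part_le id).
Qed.

(** Suppressing the tail costs a multiple of its coefficient sum, itself a bounded functional. This
    yields an explicit basis constant. *)
Lemma eqnorm_partial_sum p n (a : nat -> R) : (p <= n)%N ->
  nrm (\sum_(i < p) a i *: e i) <=
  (1 + tail_const * nrm (e 0%N)) * nrm (\sum_(i < n) a i *: e i).
Proof.
move=> pn; have := eqnorm_drop_block nrmE spr (p := p) (q := n) (r := n) _
  (block_sum e a 0 p) (block_sum e a p n) (block0 e n n).
rewrite pn leqnn !addr0 -big_cat_nat//= !big_mkord => /(_ isT) /le_trans; apply.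
rewrite mulrDl mul1r lerD2l mulrAC ler_wpM2r ?(eqnorm_ge0 nrmE)//.
exact: eqnorm_tail_le.
Qed.

End NonConstant.
End HomogeneousPart.

(** * A conditional spreading basis is not an l1-basis *)

Lemma ler_sum_injective (R : realDomainType) (F : nat -> R) (s : nat -> nat) n m :
  injective s -> (forall i, 0 <= F i) -> (forall i, (i < n)%N -> (s i < m)%N) ->
  \sum_(i < n) F (s i) <= \sum_(j < m) F j.
Proof.
move=> sI F0 sm; have -> : \sum_(i < n) F (s i) =
    \sum_(j < m) \sum_(i < n | s i == j) F j.
  rewrite (exchange_big_dep predT)//=; apply: eq_bigr => i _.
  by rewrite (big_pred1 (Ordinal (sm i (ltn_ord i))))//= => j; rewrite -val_eqE/= eq_sym.
apply: ler_sum => j _; have [[i sij]|Nij] := pselect (exists i : 'I_n, s i = j).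
  rewrite (big_pred1 i)// => k; rewrite -sij inj_eq//.
by rewrite big_pred0// => i; apply/eqP => sij; apply: Nij; exists i.
Qed.

(** A convergent expansion has bounded partial sums, hence absolutely summable coefficients; this
    survives any rearrangement, and completeness gives convergence. *)
Lemma l1_unconditional_basis (R : realType) (X : completeNormedModType R)
    (e : nat -> X) (K M : R) : schauder_basis e -> 0 <= K ->
  (forall i, `|e i| <= M) ->
  (forall n (a : nat -> R),
     \sum_(i < n) `|a i| <= K * `|\sum_(i < n) a i *: e i|) ->
  unconditional_basis e.
Proof.
move=> be K0 eM eK; split=> // a s [s0 sK _] /cvg_seq_bounded[B0 [_ /(_ (B0 + 1))]].
rewrite ltrDl ltr01 => /(_ isT) aB; set B := B0 + 1.
have M0 : 0 <= M by apply: le_trans (eM 0%N).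
apply: normed_cvg; apply: nondecreasing_is_cvgn.
  apply/nondecreasing_seqP => n; rewrite /= /series/= big_nat_recr//= lerDl//.
exists (K * B * M) => _ [n _ <-]; rewrite /= /series/= big_mkord.
apply: (@le_trans _ _ (\sum_(i < n) `|a (s i)| * M)).
  by apply: ler_sum => i _; rewrite normrZ ler_wpM2l.
rewrite -mulr_suml ler_wpM2r//.
pose m := (\max_(i < n) s i).+1.
have sm i : (i < n)%N -> (s i < m)%N.
  by move=> ni; rewrite ltnS; apply: (leq_bigmax (Ordinal ni)).
apply: le_trans (ler_sum_injective (can_inj sK) (fun i => normr_ge0 (a i)) sm) _.
apply: le_trans (eK m a) _; rewrite ler_wpM2l//.
by have := aB m I; rewrite /= /series/= big_mkord.
Qed.

(** Otherwise [d i = e i.*2 - e i.*2.+1] has a lower l1-estimate on nonnegative coefficients.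
    Suppressing some of the [d i] is free, as their coefficient sums are 0, so the estimate extends
    to all signs; and [e] dominates [d], so [e] would be an l1-basis. *)
Lemma conditional_small_differences (R : realType) (X : completeNormedModType R)
    (nrm : X -> R) (e : nat -> X) :
  equivalent_norm nrm -> one_spreading nrm e ->
  schauder_basis e -> ~ unconditional_basis e ->
  forall eps, 0 < eps -> exists (m : nat) (c : nat -> R),
    [/\ forall i, 0 <= c i, \sum_(i < m) c i = 1 &
      nrm (\sum_(i < m) c i *: (e i.*2 - e i.*2.+1)) < eps].
Proof.
move=> nrmE spr be Nue eps eps0; have [nrmD nrmZ [k0 [k1 [k00 k10 k01]]]] := nrmE.
apply: contrapT => H; apply: Nue.
pose d i := e i.*2 - e i.*2.+1.
have Hc m (c : nat -> R) : (forall i, 0 <= c i) ->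
    eps * \sum_(i < m) c i <= nrm (\sum_(i < m) c i *: d i).
  move=> c0; set S := \sum_(i < m) c i.
  have : 0 <= S by exact: sumr_ge0.
  rewrite le_eqVlt => /predU1P[<-|S0]; first by rewrite mulr0 (eqnorm_ge0 nrmE).
  rewrite leNgt; apply/negP => lt; apply: H; exists m, (fun i => c i / S); split.
  - by move=> i; rewrite divr_ge0// ltW.
  - by rewrite -mulr_suml divff// gt_eqF.
  rewrite (_ : \sum_(i < m) _ = S^-1 *: \sum_(i < m) c i *: d i).
    by rewrite nrmZ gtr0_norm ?invr_gt0// mulrC ltr_pdivrMr.
  by rewrite scaler_sumr; apply: eq_bigr => i _; rewrite scalerA mulrC.
have dsel m (a : nat -> R) (Q : pred R) :
    nrm (\sum_(i < m) (if Q (a i) then a i else 0) *: d i) <=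
    nrm (\sum_(i < m) a i *: d i).
  pose th i : R := if Q (a i) then 1 else 0.
  have := @eqnorm_scale_blocks _ _ _ _ nrmE spr
    double (fun i => a i *: d i) (fun=> 0) th m _ _ _.
  rewrite [X in _ + X * _]big1 => [|i _]; last by rewrite normr0.
  rewrite mul0r addr0 !big_mkord => h; apply: le_trans (h _ _ _).
  - rewrite le_eqVlt; apply/orP; left; apply/eqP; congr nrm.
    by apply: eq_bigr => i _; rewrite scalerA /th; case: ifP => _; rewrite ?mul1r ?mul0r.
  - by move=> j; rewrite leq_double.
  - move=> j; rewrite -[0](mulr0 (a j)); apply: blockZ.
    exists (fun i => if odd i then -1 else 1).
      rewrite doubleS (@big_ltn _ _ _ j.*2)// (@big_ltn _ _ _ j.*2.+1)// big_geq//=.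
      by rewrite odd_double/= addr0 scaleN1r scale1r.
    rewrite doubleS (@big_ltn _ _ _ j.*2)// (@big_ltn _ _ _ j.*2.+1)// big_geq//=.
    by rewrite odd_double/= addr0 addrN.
  - by move=> j; rewrite /th; case: ifP; rewrite ?lexx ler01.
(* The 4 is a factor 2 for the two sign classes and a factor 2 for dominating [d] by [e]. *)
have el1 m (a : nat -> R) :
    \sum_(i < m) `|a i| <= 4 / eps * nrm (\sum_(i < m) a i *: e i).
  have ad : nrm (\sum_(i < m) a i *: d i) <= 2 * nrm (\sum_(i < m) a i *: e i).
    have sp f : {homo f : i j / (i < j)%N} ->
        nrm (\sum_(i < m) a i *: e (f i)) = nrm (\sum_(i < m) a i *: e i).
      by move=> /increasing_seq_lt fi; exact: spr.
    rewrite (eq_bigr _ (fun i _ => scalerBr _ _ _)) sumrB.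
    apply: le_trans (eqnormB nrmE _ _) _.
    rewrite (sp double); last by move=> i j; rewrite ltn_double.
    rewrite (sp (S \o double)); last by move=> i j/=; rewrite ltnS ltn_double.
    by rewrite mulr_natl mulr2n.
  have pos := Hc m (fun i => if 0 <= a i then a i else 0) _.
  have neg := Hc m (fun i => - (if ~~ (0 <= a i) then a i else 0)) _.
  have aE : \sum_(i < m) `|a i| = \sum_(i < m) (if 0 <= a i then a i else 0)
      + \sum_(i < m) - (if ~~ (0 <= a i) then a i else 0).
    rewrite -big_split; apply: eq_bigr => i _ /=.
    case: leP => h; first by rewrite /= oppr0 addr0 ger0_norm.
    by rewrite /= add0r ltr0_norm.
  have negE : nrm (\sum_(i < m) - (if ~~ (0 <= a i) then a i else 0) *: d i) =
      nrm (\sum_(i < m) (if ~~ (0 <= a i) then a i else 0) *: d i).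
    by rewrite -[RHS](eqnormN nrmE) -sumrN; congr nrm; apply: eq_bigr => i _; rewrite scaleNr.
  rewrite mulrAC ler_pdivlMr// mulrC aE mulrDr.
  have h1 := pos _; have h2 := neg _; rewrite negE in h2.
  have {}h1 := le_trans (h1 _) (dsel m a (fun x => 0 <= x)).
  have {}h2 := le_trans (h2 _) (dsel m a (fun x => ~~ (0 <= x))).
  apply: le_trans (lerD (h1 _) (h2 _)) _.
  - by move=> i; case: ifP.
  - move=> i; case: (leP 0 (a i)) => h /=; last by rewrite oppr_ge0 ltW.
    by rewrite oppr0.
  - have -> : 4 = 2 + 2 :> R by rewrite -natrD.
    lra.
apply: (@l1_unconditional_basis _ _ _ (4 / eps * k1) (nrm (e 0%N) / k0)) => //.
- by rewrite mulr_ge0 ?divr_ge0 ?(ltW k10) ?(ltW eps0).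
- move=> i; rewrite ler_pdivlMr// mulrC -(eqnorm_basis spr i).
  by case/andP: (k01 (e i)).
move=> n a; apply: le_trans (el1 n a) _; rewrite -[leRHS]mulrA.
apply: ler_wpM2l; first by rewrite divr_ge0// ltW.
by case/andP: (k01 (\sum_(i < n) a i *: e i)).
Qed.

(** * Norming functionals and approximate projections *)

Section NormingFunctional.
Context (R : realType) (V : lmodType R).

Definition sublinear (q : V -> R) : Prop :=
  (forall x y, q (x + y) <= q x + q y) /\
  (forall t x, 0 < t -> q (t *: x) = t * q x).

Lemma sublinear0 q : sublinear q -> q 0 = 0.
Proof. by move=> [_ /(_ 2 0)]; rewrite scaler0 => /(_ (ltr0Sn _ _)); lra. Qed.

Lemma sublinearN q x : sublinear q -> - q (- x) <= q x.
Proof.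
by move=> qs; have := qs.1 x (- x); rewrite subrr sublinear0//; lra.
Qed.

(* Forcing additivity along v. *)
Definition slide (q : V -> R) (v x : V) : R :=
  inf [set q (x + t *: v) - t * q v | t in [set t | 0 <= t]].

Section Slide.
Context (q : V -> R) (qs : sublinear q) (v : V).

Let sublinear_scale t x : 0 <= t -> q (t *: x) = t * q x.
Proof.
by rewrite le_eqVlt => /predU1P[<-|/qs.2//]; rewrite scale0r mul0r (sublinear0 qs).
Qed.

Lemma slide_le x t : 0 <= t -> slide q v x <= q (x + t *: v) - t * q v.
Proof.
move=> t0; apply: ge_inf; last by exists t.
exists (- q (- x)) => _ [s s0 <-]; rewrite -sublinear_scale// lerBrDr addrC lerBlDr.
by have := qs.1 (x + s *: v) (- x); rewrite addrAC subrr add0r.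
Qed.

Lemma le_slide x r :
  (forall t, 0 <= t -> r <= q (x + t *: v) - t * q v) -> r <= slide q v x.
Proof.
move=> H; apply: lb_le_inf => [|_ [t t0 <-]]; last exact: H.
by exists (q (x + 0 *: v) - 0 * q v), 0 => /=.
Qed.

Lemma slide_le_self x : slide q v x <= q x.
Proof. by have := slide_le x (lexx 0); rewrite scale0r addr0 mul0r subr0. Qed.

Lemma slide_sublinear : sublinear (slide q v).
Proof.
have scale_le t x : 0 < t -> slide q v (t *: x) <= t * slide q v x.
  move=> t0; rewrite -ler_pdivrMl//; apply: le_slide => s s0; rewrite ler_pdivrMl//.
  apply: le_trans (slide_le _ (mulr_ge0 (ltW t0) s0)) _.
  by rewrite -scalerA -scalerDr qs.2// mulrBr mulrA.
split=> [x y|t x t0].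
  rewrite -lerBlDr; apply: le_slide => t t0; rewrite lerBlDr -lerBlDl.
  apply: le_slide => s s0; rewrite lerBlDl.
  apply: le_trans (slide_le _ (addr_ge0 t0 s0)) _.
  by have := qs.1 (x + t *: v) (y + s *: v); rewrite addrACA -scalerDl; lra.
apply/eqP; rewrite eq_le scale_le//= -ler_pdivlMl//.
apply: le_trans (scale_le _ _ _); last by rewrite invr_gt0.
by rewrite scalerA mulVf ?scale1r// gt_eqF.
Qed.

End Slide.

(** Zorn's lemma for the reversed pointwise order. The pointwise infimum of a chain is finite, every
    member being at least [- p (- x)] at [x]. *)
Lemma minimal_sublinear (p : V -> R) : sublinear p -> exists q : V -> R,
  [/\ sublinear q, forall x, q x <= p x &
    forall q', sublinear q' -> (forall x, q' x <= q x) -> q' = q].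
Proof.
move=> ps; pose T := {q : V -> R | sublinear q /\ forall x, q x <= p x}.
pose rle (q1 q2 : T) := `[< forall x, sval q2 x <= sval q1 x >].
have [|||A Atot|[q [qs qp]] qmin] := @Zorn T rle.
- by move=> q; apply/asboolP.
- move=> q1 q2 q3 /asboolP h1 /asboolP h2; apply/asboolP => x.
  exact: le_trans (h2 x) (h1 x).
- move=> [q1 ?] [q2 ?] /asboolP h1 /asboolP h2; apply: eq_exist; apply/funext => x.
  by apply/eqP; rewrite eq_le; apply/andP; split; [exact: h2|exact: h1].
- have [A0|/set0P[q0 Aq0]] := eqVneq A set0.
    by exists (exist _ p (conj ps (fun x => lexx _))); rewrite A0.
  pose q x := inf [set sval f x | f in A].
  have qle f x : A f -> q x <= sval f x.
    move=> Af; apply: ge_inf; last by exists f.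
    exists (- p (- x)) => _ [[g [gs gp]] _ <-] /=.
    by apply: le_trans (sublinearN x gs); rewrite lerN2.
  have le_q r x : (forall f, A f -> r <= sval f x) -> r <= q x.
    move=> H; apply: lb_le_inf => [|_ [f Af <-]]; last exact: H.
    by exists (sval q0 x), q0.
  have qs : sublinear q.
    split=> [x y|t x t0].
      rewrite -lerBlDr; apply: (le_q _ _) => f Af; rewrite lerBlDr -lerBlDl.
      apply: (le_q _ _) => g Ag; rewrite lerBlDl.
      have [/asboolP fg|/asboolP gf] := Atot _ _ Af Ag.
        apply: le_trans (qle _ _ Ag) _; apply: le_trans ((svalP g).1.1 _ _) _.
        by rewrite lerD2r.
      apply: le_trans (qle _ _ Af) _; apply: le_trans ((svalP f).1.1 _ _) _.
      by rewrite lerD2l.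
    apply/eqP; rewrite eq_le; apply/andP; split.
      rewrite -ler_pdivrMl//; apply: (le_q _ _) => f Af; rewrite ler_pdivrMl//.
      by apply: le_trans (qle _ _ Af) _; rewrite (svalP f).1.2.
    apply: (le_q _ _) => f Af; rewrite (svalP f).1.2// ler_pM2l//; exact: qle.
  have qp x : q x <= p x by apply: le_trans (qle _ _ Aq0) _; exact: (svalP q0).2.
  by exists (exist _ q (conj qs qp)) => f Af; apply/asboolP => x; exact: qle.
exists q; split=> // q' q's q'q.
have q'p x : q' x <= p x by apply: le_trans (q'q x) (qp x).
have := qmin (exist _ q' (conj q's q'p)) _.
by move=> /(_ _)/(congr1 sval)/= ->//; apply/asboolP.
Qed.

(** Minimality forces [slide q y = q] for each [y]; the value t = 1 in the infimum then gives
    superadditivity. *)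
Lemma minimal_sublinear_linear q : sublinear q ->
  (forall q', sublinear q' -> (forall x, q' x <= q x) -> q' = q) ->
  forall a x y, q (a *: x + y) = a * q x + q y.
Proof.
move=> qs qmin.
have qD x y : q (x + y) = q x + q y.
  apply/eqP; rewrite eq_le qs.1/= -lerBrDr.
  rewrite -{1}(qmin _ (slide_sublinear qs y) (slide_le_self qs y)).
  by have := slide_le qs y x ler01; rewrite scale1r mul1r.
have qN x : q (- x) = - q x.
  by apply/eqP; rewrite -addr_eq0 -qD addNr (sublinear0 qs).
move=> a x y; rewrite qD; congr (_ + _).
have [a0|a0|->] := ltgtP a 0; last by rewrite scale0r mul0r (sublinear0 qs).
  by rewrite -[a in LHS]opprK scaleNr qN qs.2 ?oppr_gt0// mulNr opprK.
by rewrite qs.2.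
Qed.

End NormingFunctional.

(** Hahn-Banach by minimality: the slide of the norm along [v] is at most [- |v|] at [- v], so a
    linear functional below it attains the norm at [v]. *)
Lemma norming_functional (R : realType) (X : normedModType R) (v : X) :
  exists psi : X -> R,
    [/\ forall a x y, psi (a *: x + y) = a * psi x + psi y,
        forall x, `|psi x| <= `|x| & psi v = `|v|].
Proof.
pose p (x : X) := `|x|.
have ps : sublinear p.
  split=> [x y|t x t0]; first exact: ler_normD.
  by rewrite /p normrZ gtr0_norm.
have [q [qs qp qmin]] := minimal_sublinear (slide_sublinear ps v).
have qlin := minimal_sublinear_linear qs qmin.
have q0 := sublinear0 qs.
have qN x : q (- x) = - q x by rewrite -scaleN1r -[_ *: x]addr0 qlin q0 mulN1r addr0.
have qle x : q x <= `|x| by apply: le_trans (qp x) (slide_le_self ps v x).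
exists q; split=> // [x|]; first by rewrite ler_norml qle lerNl -qN -normrN qle.
apply/eqP; rewrite eq_le qle/= -lerN2 -qN; apply: le_trans (qp _) _.
by have := slide_le ps v (- v) ler01; rewrite scale1r addNr mul1r /p normr0 sub0r.
Qed.

Section BoundedLinear.
Context (R : realType) (X : normedModType R).

Lemma linear_bound_continuous (W : normedModType R) (T : {linear X -> W}) (C : R) :
  (forall x, `|T x| <= C * `|x|) -> continuous T.
Proof.
move=> TC; apply: bounded_linear_continuous; apply/linear_boundedP.
near=> r => x; apply: le_trans (TC x) _; rewrite ler_wpM2r//.
Unshelve. all: by end_near. Qed.

Lemma pointwise_limit_linear (W : normedModType R) (u : nat -> X -> W) (C : R) :
  (forall n a x y, u n (a *: x + y) = a *: u n x + u n y) ->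
  (forall x, cvgn (fun n => u n x)) ->
  (forall n x, `|u n x| <= C * `|x|) ->
  exists P : {linear X -> W}, (forall x, (fun n => u n x) @ \oo --> P x) /\
    forall x, `|P x| <= C * `|x|.
Proof.
move=> ulin ucvg uC; pose f x : W := lim ((fun n => u n x) @ \oo).
have fcvg x : (fun n => u n x) @ \oo --> f x by exact: ucvg.
have flin : linear f.
  move=> a x y; apply: (@cvg_lim _ (@norm_hausdorff _ _)).
  have -> : (fun n => u n (a *: x + y)) = (fun n => a *: u n x + u n y).
    by apply/funext => n; rewrite ulin.
  by apply: cvgD => //; apply: cvgZr.
pose fM := GRing.isLinear.Build _ _ _ _ _ flin.
pose P : {linear X -> W} := HB.pack f fM.
exists P; split=> // x; apply: (ler_cvg_to (cvg_norm (fcvg x)) (cvg_cst _)).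
by near do exact: uC.
Unshelve. all: by end_near. Qed.

End BoundedLinear.

Lemma sum_half_expn_le (R : realFieldType) n : \sum_(0 <= k < n) (2^-1 : R) ^+ k <= 2.
Proof.
have -> : \sum_(0 <= k < n) (2^-1 : R) ^+ k = 2 - 2 * 2^-1 ^+ n.
  elim: n => [|n IH]; first by rewrite big_geq// expr0 mulr1 subrr.
  by rewrite big_nat_recr//= IH exprS; field.
by rewrite gerBl mulr_ge0// exprn_ge0// invr_ge0.
Qed.

Section Complemented.
Context (R : realType) (X : completeNormedModType R).

(* P x = \sum_n (1 - T)^n (T x): a Neumann series inverting T on Y. *)
Lemma complemented_of_approximate_projection (Y : set X) (T : {linear X -> X}) (C : R) :
  closed Y -> Y 0 -> (forall a x y, Y x -> Y y -> Y (a *: x + y)) ->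
  (forall x, `|T x| <= C * `|x|) -> (forall x, Y (T x)) ->
  (forall x, Y x -> `|x - T x| <= 2^-1 * `|x|) -> complemented Y.
Proof.
move=> Yc Y0 Ylin TC YT TY; pose S x := x - T x.
have Slin a x y : S (a *: x + y) = a *: S x + S y.
  by rewrite /S linearP scalerBr opprD addrACA.
have SnC n x : `|iter n S (T x)| <= (2^-1) ^+ n * (C * `|x|) /\ Y (iter n S (T x)).
  elim: n => [|n [IH YI]]/=; first by rewrite expr0 mul1r.
  split; last by rewrite /S -scaleN1r addrC; exact: Ylin.
  by apply: le_trans (TY _ YI) _; rewrite exprS -mulrA ler_wpM2l// invr_ge0.
have Snlin n a x y : iter n S (T (a *: x + y)) = a *: iter n S (T x) + iter n S (T y).
  by elim: n => [|n IH]/=; [rewrite linearP|rewrite IH Slin].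
pose u n x := \sum_(0 <= k < n) iter k S (T x).
have YS n x : Y (u n x).
  rewrite /u; elim: n => [|n IH]; first by rewrite big_geq.
  by rewrite big_nat_recr//= addrC -[iter _ _ _]scale1r; apply: Ylin => //; exact: (SnC n x).2.
have uC n x : `|u n x| <= (2 * C) * `|x|.
  apply: le_trans (ler_norm_sum _ _ _) _.
  apply: (@le_trans _ _ (\sum_(0 <= k < n) (2^-1) ^+ k * (C * `|x|))).
    by apply: ler_sum => k _; exact: (SnC k x).1.
  rewrite -mulr_suml -mulrA; apply: ler_wpM2r (sum_half_expn_le R n).
  exact: le_trans (normr_ge0 _) (TC x).
have [n a x y|x|P [Pcvg PC]] := @pointwise_limit_linear R X X u (2 * C) _ _ uC.
- by rewrite /u scaler_sumr -big_split; apply: eq_bigr => k _; rewrite Snlin.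
- apply: normed_cvg; apply: (@series_le_cvg _ _ (geometric (C * `|x|) 2^-1)).
  + by move=> n; exact: normr_ge0.
  + move=> n; rewrite /geometric/= mulr_ge0 ?exprn_ge0 ?invr_ge0//.
    exact: le_trans (normr_ge0 _) (TC x).
  + by move=> n; rewrite /geometric/= mulrC; exact: (SnC n x).1.
  + by apply: is_cvg_geometric_series; rewrite ger0_norm ?invr_ge0// invf_lt1// ltr1n.
have PY x : Y (P x) by apply: (closed_cvg Y Yc _ _ (Pcvg x)); near do exact: YS.
(* On [Y] the sums telescope to [x - iter n S x], and [S] halves norms there. *)
have Pid x : Y x -> P x = x.
  move=> Yx; apply: (@cvg_unique _ (@norm_hausdorff _ X) _ _ _ _ (Pcvg x)).
  have YSn n : Y (iter n S x) /\ `|iter n S x| <= 2^-1 ^+ n * `|x|.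
    elim: n => [|n [YI IH]]/=; first by rewrite expr0 mul1r.
    split; first by rewrite {1}/S -scaleN1r addrC; exact: Ylin.
    by apply: le_trans (TY _ YI) _; rewrite exprS -mulrA ler_wpM2l// invr_ge0.
  have STn n : iter n S (T x) = iter n S x - iter n.+1 S x.
    elim: n => [|n IH]/=; first by rewrite /S opprB addrC subrK.
    by rewrite IH /= -[iter n S x - _]addrC -scaleN1r Slin scaleN1r addrC.
  have uE n : u n x = x - iter n S x.
    rewrite /u; elim: n => [|n IH]; first by rewrite big_geq// subrr.
    by rewrite big_nat_recr//= IH STn addrA subrK.
  rewrite (_ : (fun n => u n x) = (fun n => x - iter n S x)); last exact/funext.
  suff : (fun n => x - iter n S x) @ \oo --> x - 0 by rewrite subr0.
  apply: cvgB; first exact: cvg_cst.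
  apply/norm_cvg0P; apply: (@squeeze_cvgr _ _ _ _ (fun=> 0) (geometric `|x| 2^-1)).
  + near=> n; rewrite normr_ge0/= mulrC; exact: (YSn n).2.
  + exact: cvg_cst.
  + by apply: cvg_geometric; rewrite ger0_norm ?invr_ge0// invf_lt1// ltr1n.
exists P; split; first exact: linear_bound_continuous PC.
- by move=> x; rewrite Pid.
- by apply/seteqP; split=> [_ [x _ <-]//|x Yx]; exists x => //; exact: Pid.
Unshelve. all: by end_near. Qed.

End Complemented.

(** * Operators defined on a basis *)

Lemma sum_ord_trim (V : nmodType) (f : nat -> V) n m : (n <= m)%N ->
  (forall i, (n <= i < m)%N -> f i = 0) -> \sum_(i < m) f i = \sum_(i < n) f i.
Proof.
move=> nm f0; rewrite -!(big_mkord xpredT f) (@big_cat_nat _ _ _ n 0 m)//=.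
by rewrite [X in _ + X](_ : _ = 0) ?addr0// big_nat big1.
Qed.

Lemma sum_ord_behead (V : nmodType) (f : nat -> V) n m : (n <= m)%N ->
  (forall i, (i < n)%N -> f i = 0) -> \sum_(i < m) f i = \sum_(n <= i < m) f i.
Proof.
move=> nm f0; rewrite -(big_mkord xpredT f) (@big_cat_nat _ _ _ n 0 m)//=.
by rewrite [X in X + _](_ : _ = 0) ?add0r// big_nat big1.
Qed.

Section ClosedSpan.
Context (R : realType) (X : normedModType R) (y : nat -> X).

Lemma closed_spanP v : closed_span y v <->
  forall eps, 0 < eps -> exists n (a : nat -> R),
    `|v - \sum_(i < n) a i *: y i| < eps.
Proof.
split=> [yv eps eps0|H B /nbhs_ballP[eps /= eps0 epsB]].
  have [_ [[n [a ->]] h]] := yv _ (nbhsx_ballx v eps eps0).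
  by exists n, a; rewrite -ball_normE in h.
have [n [a h]] := H _ eps0; exists (\sum_(i < n) a i *: y i); split.
  by exists n, a.
by apply: epsB; rewrite -ball_normE.
Qed.

Lemma closed_span_sum n (a : nat -> R) : closed_span y (\sum_(i < n) a i *: y i).
Proof. by apply: subset_closure; exists n, a. Qed.

Lemma closed_span_elt i : closed_span y (y i).
Proof.
have := @closed_span_sum i.+1 (fun j => (j == i)%:R).
rewrite big_ord_recr/= eqxx scale1r big1 ?add0r// => j _.
by rewrite ltn_eqF ?scale0r.
Qed.

Lemma closed_span0 : closed_span y 0.
Proof. by have := @closed_span_sum 0 (fun=> 0); rewrite big_ord0. Qed.

Lemma closed_span_linear a u v :
  closed_span y u -> closed_span y v -> closed_span y (a *: u + v).
Proof.
move=> /closed_spanP yu /closed_spanP yv; apply/closed_spanP => eps eps0.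
have a0 : 0 < `|a| + 1 by rewrite ltr_wpDl.
have [n [b nb]] := yu (eps / 2 / (`|a| + 1)) (divr_gt0 (divr_gt0 eps0 (ltr0Sn _ _)) a0).
have [m [c mc]] := yv (eps / 2) (divr_gt0 eps0 (ltr0Sn _ _)).
pose ext k (b : nat -> R) i := if (i < k)%N then b i else 0.
have extE k l d : (k <= l)%N -> \sum_(i < l) ext k d i *: y i = \sum_(i < k) d i *: y i.
  move=> kl; rewrite (@sum_ord_trim _ (fun i => ext k d i *: y i) k)//.
    by apply: eq_bigr => i _; rewrite /ext ltn_ord.
  by move=> i /andP[ki _]; rewrite /ext ltnNge ki scale0r.
exists (n + m)%N, (fun i => a * ext n b i + ext m c i).
have -> : \sum_(i < n + m) (a * ext n b i + ext m c i) *: y i =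
    a *: (\sum_(i < n) b i *: y i) + \sum_(i < m) c i *: y i.
  rewrite -(extE n (n + m)%N b) ?leq_addr// -(extE m (n + m)%N c) ?leq_addl//.
  rewrite scaler_sumr -big_split; apply: eq_bigr => i _.
  by rewrite scalerDl scalerA.
rewrite opprD addrACA -scalerBr; apply: le_lt_trans (ler_normD _ _) _.
rewrite normrZ [ltRHS]splitr; apply: ler_ltD => //.
apply: (@le_trans _ _ ((`|a| + 1) * (eps / 2 / (`|a| + 1)))).
  by apply: ler_pM => //; [rewrite lerDl|exact: ltW].
by rewrite mulrC divfK// gt_eqF.
Qed.

Lemma closed_span_cvg_sum (g : nat -> X) (a : nat -> R) v :
  (forall i, closed_span y (g i)) ->
  (fun n => \sum_(i < n) a i *: g i) @ \oo --> v -> closed_span y v.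
Proof.
move=> yg; apply: closed_cvg; first exact: closed_closure.
apply: nearW; elim=> [|m IH]; first by rewrite big_ord0; exact: closed_span0.
by rewrite big_ord_recr/= addrC; apply: closed_span_linear.
Qed.

End ClosedSpan.

Lemma complemented_closed_span (R : realType) (X : completeNormedModType R)
    (y : nat -> X) (T : {linear X -> X}) (C : R) :
  (forall x, `|T x| <= C * `|x|) -> (forall x, closed_span y (T x)) ->
  (forall n (a : nat -> R), `|\sum_(i < n) a i *: (y i - T (y i))| <=
     2^-1 * `|\sum_(i < n) a i *: y i|) ->
  complemented (closed_span y).
Proof.
move=> TC yT Ty.
apply: (complemented_of_approximate_projection _ (@closed_span0 _ _ y) _ TC yT).
- exact: closed_closure.
- exact: closed_span_linear.
move=> x /closed_spanP yx.
have C0 : 0 <= `|C| by [].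
apply/ler_addgt0Pr => eps eps0.
(* Replacing [x] by [v] costs [|x - v|] once directly, at most [|C|] times through [T], and one half
   more through [|v|]: less than [|C| + 2] times in all. *)
have [n [a]] := yx (eps / (`|C| + 2)) (divr_gt0 eps0 (ltr_wpDl C0 (ltr0Sn _ _))).
rewrite ltr_pdivlMr ?ltr_wpDl//; set v := \sum_(i < n) _ => xv.
have Tv : v - T v = \sum_(i < n) a i *: (y i - T (y i)).
  rewrite /v raddf_sum/= -sumrB; apply: eq_bigr => i _.
  by rewrite linearZ/= scalerBr.
have := Ty n a; rewrite -Tv -/v => vTv.
have -> : x - T x = (x - v) + ((v - T v) - T (x - v)).
  by rewrite linearB/= opprB addrA !subrKA.
have h1 : `|v| <= `|x| + `|x - v|.
  by rewrite -{1}[v](subKr x); exact: ler_normB.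
have h2 : `|T (x - v)| <= `|C| * `|x - v|.
  by apply: le_trans (TC _) _; rewrite ler_wpM2r// ler_norm.
have := ler_normD (x - v) ((v - T v) - T (x - v)).
have := ler_normB (v - T v) (T (x - v)).
have := normr_ge0 (x - v).
lra.
Qed.

Section Coefficients.
Context (R : realType) (X : completeNormedModType R) (e : nat -> X).
Context (be : schauder_basis e).

Definition coef (x : X) : nat -> R := sval (cid (be x)).

Lemma cvg_coef x : (fun n => \sum_(i < n) coef x i *: e i) @ \oo --> x.
Proof.
rewrite /coef; case: cid => a [/= ax _]; move: ax; rewrite /series/=.
by under eq_fun do rewrite big_mkord.
Qed.

Lemma coef_unique x (a : nat -> R) :
  (fun n => \sum_(i < n) a i *: e i) @ \oo --> x -> coef x = a.
Proof.
move=> ax; rewrite /coef; case: cid => b [/= _]; apply; rewrite /series/=.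
by under eq_fun do rewrite big_mkord.
Qed.

Lemma coef_linear c x y i : coef (c *: x + y) i = c * coef x i + coef y i.
Proof.
suff -> : coef (c *: x + y) = (fun i => c * coef x i + coef y i) by [].
apply: coef_unique.
rewrite (_ : (fun n => _) = (fun n => c *: (\sum_(i < n) coef x i *: e i) +
    \sum_(i < n) coef y i *: e i)); last first.
  apply/funext => n; rewrite scaler_sumr -big_split; apply: eq_bigr => j _.
  by rewrite scalerDl scalerA.
by apply: cvgD; [apply: cvgZr|]; exact: cvg_coef.
Qed.

Lemma coef_sum n (a : nat -> R) i :
  coef (\sum_(j < n) a j *: e j) i = if (i < n)%N then a i else 0.
Proof.
suff -> : coef (\sum_(j < n) a j *: e j) =
  (fun i => if (i < n)%N then a i else 0) by [].
apply: coef_unique; apply: cvg_near_cst; near=> m.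
have nm : (n <= m)%N by near: m; exact: nbhs_infty_ge.
rewrite (@sum_ord_trim _ (fun j => (if (j < n)%N then a j else 0) *: e j) n)//.
  by apply: eq_bigr => j _; rewrite ltn_ord.
by move=> j /andP[nj _]; rewrite ltnNge nj scale0r.
Unshelve. all: by end_near. Qed.

Definition partial_sum n x := \sum_(i < n) coef x i *: e i.

Context (K : R).
Context (eK : forall p n (a : nat -> R), (p <= n)%N ->
  `|\sum_(i < p) a i *: e i| <= K * `|\sum_(i < n) a i *: e i|).

Lemma partial_sum_le n x : `|partial_sum n x| <= K * `|x|.
Proof.
have h1 : `|partial_sum n x| @[_ --> \oo] --> `|partial_sum n x| by exact: cvg_cst.
have h2 : K * `|\sum_(i < m) coef x i *: e i| @[m --> \oo] --> K * `|x|.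
  by apply: cvgM; [exact: cvg_cst|apply: cvg_norm; exact: cvg_coef].
apply: (ler_cvg_to h1 h2).
by near=> m; apply: eK; near: m; exact: nbhs_infty_ge.
Unshelve. all: by end_near. Qed.

(** The truncated sums are at most [C] times the partial sums of [x], whence the factor [K]; they
    are Cauchy because domination also applies to each block of the expansion. *)
Lemma basis_operator (W : completeNormedModType R) (g : nat -> W) (C : R) : 0 <= C ->
  (forall n (a : nat -> R),
     `|\sum_(i < n) a i *: g i| <= C * `|\sum_(i < n) a i *: e i|) ->
  exists T : {linear X -> W}, [/\ forall x, `|T x| <= C * K * `|x|,
    forall i, T (e i) = g i &
    forall x, (fun n => \sum_(i < n) coef x i *: g i) @ \oo --> T x].
Proof.
move=> C0 gC; pose u n x := \sum_(i < n) coef x i *: g i.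
have [n c x y|x|n x|T [Tcvg TC]] := @pointwise_limit_linear R X W u (C * K).
- rewrite /u scaler_sumr -big_split; apply: eq_bigr => j _.
  by rewrite coef_linear scalerDl scalerA.
- have -> : (fun n => u n x) = series (fun i => coef x i *: g i).
    by apply/funext => n; rewrite /series/= big_mkord.
  apply/cauchy_cvgP/cauchy_seriesP => eps eps0.
  have /cauchy_cvgP/cauchy_seriesP : cvgn (series (fun i => coef x i *: e i)).
    apply/cvg_ex; exists x; rewrite /series/=.
    by under eq_fun do rewrite big_mkord; exact: cvg_coef.
  move=> /(_ (eps / (C + 1))); rewrite divr_gt0 ?ltr_wpDl// => /(_ isT).
  apply: filter_app; near=> n; rewrite ltr_pdivlMr ?ltr_wpDl// => h.
  have [nn|nn] := leqP n.2 n.1; first by rewrite big_geq// normr0.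
  have := gC n.2 (fun i => if (n.1 <= i)%N then coef x i else 0).
  have cutE (V : lmodType R) (f : nat -> V) :
      \sum_(i < n.2) (if (n.1 <= i)%N then coef x i else 0) *: f i =
      \sum_(n.1 <= i < n.2) coef x i *: f i.
    rewrite (@sum_ord_behead _ (fun i => (if (n.1 <= i)%N then coef x i else 0) *: f i) n.1).
    - by apply: eq_big_nat => i /andP[-> _].
    - exact: ltnW.
    - by move=> i i1; rewrite leqNgt i1 scale0r.
  rewrite !cutE => /le_lt_trans; apply.
  apply: le_lt_trans h; rewrite mulrC ler_wpM2l// lerDl//.
- apply: le_trans (gC _ _) _; rewrite -mulrA ler_wpM2l//; exact: partial_sum_le.
exists T; split=> // i; apply: (@cvg_unique _ (@norm_hausdorff _ W) _ _ _ _ (Tcvg _)).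
have eE : e i = \sum_(j < i.+1) (j == i :> nat)%:R *: e j.
  rewrite big_ord_recr/= eqxx scale1r big1 ?add0r// => j _.
  by rewrite ltn_eqF ?scale0r.
have ce j : coef (e i) j = (j == i)%:R.
  rewrite {1}eE (coef_sum i.+1 (fun j => (j == i)%:R)).
  by case: ltnP => // ij; rewrite gtn_eqF.
apply: cvg_near_cst; near=> m.
have im : (i < m)%N by near: m; exact: nbhs_infty_gt.
rewrite /u (@sum_ord_trim _ (fun j => coef (e i) j *: g j) i.+1)//.
  rewrite big_ord_recr/= ce eqxx scale1r big1 ?add0r// => j _.
  by rewrite ce ltn_eqF ?scale0r.
by move=> j /andP[ij _]; rewrite ce gtn_eqF ?scale0r.
Unshelve. all: by end_near. Qed.

End Coefficients.

(** * Gliding hump *)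

Lemma ultra_cvg_bounded (R : realType) (U : set_system nat) (u : nat -> R) (M : R) :
  UltraFilter U -> (forall k, `|u k| <= M) -> exists l : R, u @ U --> l.
Proof.
move=> UU uM; have UP := @ultra_proper _ _ UU.
have UM : fmap u U `[- M, M]%classic.
  apply: (@filterE _ U) => k /=; rewrite in_itv/= -ler_norml; exact: uM.
have [l [_ lu]] := segment_compact (F := fmap u U) _ UM; exists l => B lB.
have [//|UNB] := in_ultra_setVsetC (u @^-1` B) UU.
have [r [rNB rB]] := lu (~` B) B UNB lB; by case: (rNB rB).
Qed.

Section GlidingHump.
Context (R : realType) (X : completeNormedModType R) (e : nat -> X).
Context (be : schauder_basis e) (K L : R).
Context (eK : forall p n (a : nat -> R), (p <= n)%N ->
  `|\sum_(i < p) a i *: e i| <= K * `|\sum_(i < n) a i *: e i|).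
Context (eL : forall p n (a : nat -> R),
  `|\sum_(p <= i < n) a i| <= L * `|\sum_(i < n) a i *: e i|).
Context (K0 : 0 <= K) (L0 : 0 <= L).
Context (y : nat -> X) (M : R) (yM : forall k, `|y k| <= M).

Local Notation coef := (coef be).

(* b and sigma are the limits, along a nonprincipal ultrafilter, of the
   coefficients and of the coefficient sums of y; only the resulting
   simultaneous approximations are recorded. *)
Definition limit_coefficients (b : nat -> R) (sigma : R) : Prop :=
  exists s : {linear X -> R^o}, [/\ forall x, `|s x| <= L * K * `|x|,
    forall n (a : nat -> R), s (\sum_(i < n) a i *: e i) = \sum_(i < n) a i &
    forall n k0 (eps : R), 0 < eps -> exists k, [/\ (k0 < k)%N,
      `|\sum_(i < n) coef (y k) i *: e i - \sum_(i < n) b i *: e i| < eps,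
      `|\sum_(i < n) coef (y k) i - \sum_(i < n) b i| < eps &
      `|s (y k) - sigma| < eps]].

Lemma exists_limit_coefficients : exists b sigma, limit_coefficients b sigma.
Proof.
have sumE n (a : nat -> R) : \sum_(i < n) a i *: (1 : R^o) = \sum_(i < n) a i.
  by apply: eq_bigr => i _; rewrite -[LHS]/(a i * 1) mulr1.
(* The coefficient-sum functional is the basis operator sending every [e i] to 1. *)
have [n a|s [sC sE _]] := @basis_operator R X e be K eK R^o (fun=> 1) L L0.
  by rewrite sumE -(big_mkord xpredT a); exact: eL.
have [U [UU sU]] := @ultraFilterLemma nat \oo _.
have coefM i k : `|coef (y k) i| <= L * K * M.
  have := eL i i.+1 (coef (y k)); rewrite big_nat1 => /le_trans; apply.
  rewrite -mulrA ler_wpM2l//; apply: le_trans (partial_sum_le be eK i.+1 (y k)) _.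
  by rewrite ler_wpM2l.
have /choice[b bE] : forall i, exists l : R, (fun k => coef (y k) i) @ U --> l.
  by move=> i; apply: (ultra_cvg_bounded UU (coefM i)).
have [sigma sigmaE] : exists l : R, (fun k => s (y k) : R) @ U --> l.
  apply: (@ultra_cvg_bounded _ _ _ (L * K * M) UU) => k.
  by apply: le_trans (sC _) _; rewrite ler_wpM2l// mulr_ge0.
exists b, sigma, s; split=> // [n a|n k0 eps eps0].
  by rewrite linear_sum/= -sumE; apply: eq_bigr => i _; rewrite linearZ/= sE.
have h1 : (fun k => \sum_(i < n) coef (y k) i *: e i) @ U --> \sum_(i < n) b i *: e i.
  elim: n => [|n IH].
    by under eq_fun do rewrite big_ord0; rewrite big_ord0; exact: cvg_cst.
  under eq_fun do rewrite big_ord_recr/=.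
  by rewrite big_ord_recr/=; apply: cvgD => //; apply: cvgZr_tmp; exact: bE.
have h2 : (fun k => \sum_(i < n) coef (y k) i) @ U --> \sum_(i < n) b i.
  elim: n {h1} => [|n IH].
    by under eq_fun do rewrite big_ord0; rewrite big_ord0; exact: cvg_cst.
  under eq_fun do rewrite big_ord_recr/=.
  by rewrite big_ord_recr/=; apply: cvgD => //; exact: bE.
have UF := @ultra_proper _ _ UU.
have /cvgrPdist_lt/(_ _ eps0) H1 := h1.
have /cvgrPdist_lt/(_ _ eps0) H2 := h2.
have /cvgrPdist_lt/(_ _ eps0) H3 := sigmaE.
near U => k; exists k; split.
- by near: k; apply: sU; exact: nbhs_infty_gt.
- by rewrite distrC; near: k; exact: H1.
- by rewrite distrC; near: k; exact: H2.
- by rewrite distrC; near: k; exact: H3.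
Unshelve. all: by end_near. Qed.

Context (b : nat -> R) (sigma : R) (lim_b : limit_coefficients b sigma).

Lemma limit_partial_sum_bound n : `|\sum_(i < n) b i *: e i| <= K * M.
Proof.
have [s [_ _ H]] := lim_b; apply/ler_addgt0Pr => eps eps0.
have [k [_ h _ _]] := H n 0%N eps eps0.
have := partial_sum_le be eK n (y k); rewrite /partial_sum => hk.
have := ler_wpM2l K0 (yM k) => hM.
rewrite -[X in `|X|](subKr (\sum_(i < n) coef (y k) i *: e i)).
by apply: le_trans (ler_normB _ _) _; apply: lerD; [exact: le_trans hM|exact: ltW].
Qed.

Context (beta : R) (G : nat -> nat -> Prop).
Context (betaG : forall m N (eta : R), 0 < eta -> exists n,
  [/\ (N <= n)%N, `|\sum_(i < n) b i - beta| < eta & G m n]).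

(** Each step first picks a term of [y] close to [b] before the current cut, then a cut beyond which
    the tail of that term is negligible. [G] leaves room for a further condition on consecutive
    cuts. *)
Lemma gliding_hump (eps : nat -> R) : (forall k, 0 < eps k) ->
  exists n f : nat -> nat,
    [/\ forall k, (n k < n k.+1)%N, increasing_seq f,
      forall k, G (n k) (n k.+1),
      forall k, `|\sum_(i < n k) b i - beta| < eps k &
      forall k, exists w t, [/\ block e (n k) (n k.+1) w t,
        `|y (f k) - (\sum_(i < n k) b i *: e i + w)| < eps k &
        `|\sum_(i < n k) b i + t - sigma| < eps k]].
Proof.
move=> eps0; have [s [sC sE H]] := lim_b.
pose S n := \sum_(i < n) b i; pose B n := \sum_(i < n) b i *: e i.
pose st := {p : nat * nat * nat | `|S p.1.2 - beta| < eps p.1.1}.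
pose step (p q : st) := let: (k, n, f) := sval p in let: (k', n', f') := sval q in
  [/\ k' = k.+1, (n < n')%N, (f < f')%N, G n n' &
    exists w t, [/\ block e n n' w t, `|y f' - (B n + w)| < eps k &
      `|S n + t - sigma| < eps k]].
have stepP p : {q | step p q}.
  apply: cid; case: p => -[[k n] f] /= nk.
  have eps2 : 0 < eps k / 2 by rewrite divr_gt0.
  have eps3 : 0 < eps k / 3 by rewrite divr_gt0.
  have eps32 : eps k / 3 < eps k / 2.
    by rewrite ltr_pM2l// ltf_pV2 ?posrE// ltr_nat.
  have [f' [ff' h1 h2 h3]] := H n f _ eps3.
  (* Dividing by this [C] makes the tail small for [s] as well, whose norm is at most [L * K]. *)
  pose C := L * K + 1; have C0 : 0 < C by rewrite ltr_wpDl// mulr_ge0.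
  have [N _ HN] : \forall m \near \oo,
      `|y f' - \sum_(i < m) coef (y f') i *: e i| < eps k / 3 / C.
    by move/cvgrPdist_lt: (@cvg_coef _ _ _ be (y f')); apply; rewrite divr_gt0.
  have [n' [n'N n'b n'G]] := betaG n (maxn N n.+1) (eps0 k.+1).
  have nn' : (n < n')%N by apply: leq_trans n'N; exact: leq_maxr.
  have {HN} h4 := HN n' (leq_trans (leq_maxl _ _) n'N).
  exists (exist _ (k.+1, n', f') n'b) => /=; split=> //.
  exists (\sum_(n <= i < n') coef (y f') i *: e i), (\sum_(n <= i < n') coef (y f') i).
  have cat (V : nmodType) (F : nat -> V) :
      \sum_(i < n) F i + \sum_(n <= i < n') F i = \sum_(i < n') F i.
    by rewrite -!(big_mkord xpredT F) -big_cat_nat//= ltnW.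
  have h5 : `|s (y f') - \sum_(i < n') coef (y f') i| < eps k / 3.
    rewrite -sE -linearB/=; apply: le_lt_trans (sC _) _.
    move: h4; rewrite ltr_pdivlMr// => /(le_lt_trans _); apply.
    by rewrite mulrC ler_wpM2l// lerDl.
  split; first exact: block_sum.
    rewrite (_ : _ - _ = (y f' - \sum_(i < n') coef (y f') i *: e i) +
      (\sum_(i < n) coef (y f') i *: e i - B n)); last first.
      rewrite -(cat _ (fun i => coef (y f') i *: e i))/=.
      suff H' (u v w x : X) : u - (v + w) = u - (x + w) + (x - v) by exact: H'.
      by rewrite [x + w]addrC !opprD addrA [in RHS](addrA u) subrKA addrAC.
    apply: le_lt_trans (ler_normD _ _) _; rewrite [ltRHS]splitr; apply: ltrD.
      apply: lt_trans h4 _; rewrite ltr_pdivrMr//; apply: lt_le_trans eps32 _.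
      by rewrite ler_peMr ?(ltW eps2)// lerDr mulr_ge0.
    exact: lt_trans h1 eps32.
  have := cat _ (coef (y f')); move: h2 h3 h5.
  rewrite /S; move: (\sum_(i < n) b i) (\sum_(i < n) coef _ i) (\sum_(n <= i < n') _)
     (\sum_(i < n') _) => S1 S2 S3 S4.
  rewrite !ltr_norml => /andP[? ?] /andP[? ?] /andP[? ?] ?; apply/andP; split; lra.
have [n0 [_ n0b _]] := betaG 0 0 (eps0 0%N).
have [g [g0 gS]] := dependent_choice stepP (exist _ (0%N, n0, 0%N) n0b).
have gk k : (sval (g k)).1.1 = k.
  elim: k => [|k IH]; first by rewrite g0.
  move: (gS k); rewrite /step; case: (sval (g k)) IH => -[k1 n1] f1 /= ->.
  by case: (sval (g k.+1)) => -[k2 n2] f2 /= [-> _ _ _ _].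
(* The term whose hump lies between cuts [k] and [k.+1] is recorded in state [k.+1], hence the shift
   for [f]. *)
exists (fun k => (sval (g k)).1.2), (fun k => (sval (g k.+1)).2).
have gS' k := gS k.
split.
- move=> k; move: (gS k); rewrite /step.
  by case: (sval (g k)) => -[? ?] ?; case: (sval (g k.+1)) => -[? ?] ? [].
- apply/increasing_seqP => k; move: (gS k.+1); rewrite /step.
  by case: (sval (g k.+1)) => -[? ?] ?; case: (sval (g k.+2)) => -[? ?] ? [].
- move=> k; move: (gS k); rewrite /step.
  by case: (sval (g k)) => -[? ?] ?; case: (sval (g k.+1)) => -[? ?] ? [].
- by move=> k; rewrite -[X in eps X](gk k); exact: (svalP (g k)).
- move=> k; move: (gS k) (gk k); rewrite /step.
  case: (sval (g k)) => -[? ?] ?; case: (sval (g k.+1)) => -[? ?] ? /=.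
  by move=> [_ _ _ _ H'] <-.
Qed.

End GlidingHump.

(** * Coefficient sums with another cluster point *)

(** Summation by parts puts tail sums of [a] in front of the [q j]. With N the norm of the
    combination of [y], tail sums are at most [L * N] and single coefficients at most [2 * L * N];
    the geometric series give [6 * L * delta * N], hence the 12. *)
Lemma small_perturbation (R : realType) (X : normedModType R) (y v q r : nat -> X)
    (L delta : R) :
  (forall p n (a : nat -> R),
    `|\sum_(p <= i < n) a i| <= L * `|\sum_(i < n) a i *: y i|) ->
  0 <= L -> 0 <= delta -> 12 * L * delta <= 1 ->
  (forall j, `|q j| <= delta * 2^-1 ^+ j) ->
  (forall j, `|r j| <= delta * 2^-1 ^+ j) ->
  (forall k, v k = \sum_(j < k) q j + r k) ->
  forall n (a : nat -> R),
    `|\sum_(i < n) a i *: v i| <= 2^-1 * `|\sum_(i < n) a i *: y i|.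
Proof.
move=> yL L0 d0 Ld qd rd vE n a; set N := `|\sum_(i < n) a i *: y i|.
have -> : \sum_(i < n) a i *: v i =
    \sum_(0 <= j < n) (\sum_(j.+1 <= k < n) a k) *: q j + \sum_(0 <= j < n) a j *: r j.
  rewrite !big_mkord; under eq_bigr do rewrite vE scalerDr.
  rewrite big_split/=; congr (_ + _).
  elim: n {N} => [|n IH]; first by rewrite !big_ord0.
  rewrite !big_ord_recr/= IH [in RHS]big_geq// scale0r addr0 scaler_sumr -big_split/=.
  by apply: eq_bigr => j _; rewrite big_nat_recr//= scalerDl.
have aN j : (j < n)%N -> `|a j| <= 2 * L * N.
  move=> jn; have h1 := yL j n a; have h2 := yL j.+1 n a.
  have -> : a j = \sum_(j <= i < n) a i - \sum_(j.+1 <= i < n) a i.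
    by rewrite big_ltn// addrK.
  by apply: le_trans (ler_normB _ _) _; rewrite /N; lra.
have geo (c : R) (u : nat -> X) : 0 <= c ->
    (forall j, (j < n)%N -> `|u j| <= c * (delta * 2^-1 ^+ j)) ->
    `|\sum_(0 <= j < n) u j| <= c * delta * 2.
  move=> c0 H; apply: le_trans (ler_norm_sum _ _ _) _.
  apply: (@le_trans _ _ (\sum_(0 <= j < n) c * (delta * 2^-1 ^+ j))).
    by rewrite !big_mkord; apply: ler_sum => j _; apply: H.
  rewrite -!mulr_sumr mulrA ler_wpM2l ?mulr_ge0//; exact: sum_half_expn_le.
have N0 : 0 <= N by exact: normr_ge0.
have LN : 0 <= L * N by exact: mulr_ge0.
have h1 : `|\sum_(0 <= j < n) (\sum_(j.+1 <= k < n) a k) *: q j| <= L * N * delta * 2.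
  by apply: geo => // j _; rewrite normrZ; apply: ler_pM => //; exact: yL.
have h2 : `|\sum_(0 <= j < n) a j *: r j| <= 2 * L * N * delta * 2.
  apply: geo => [|j jn]; first by rewrite -mulrA mulr_ge0.
  by rewrite normrZ; apply: ler_pM => //; exact: aN.
apply: le_trans (ler_normD _ _) _; apply: le_trans (lerD h1 h2) _.
have := ler_wpM2r N0 Ld; rewrite mul1r; lra.
Qed.

(** Indices before [n 0] also get the value 0, so the operators built from [kappa] treat them
    separately. *)
Lemma block_index (n : nat -> nat) : (forall k, (n k < n k.+1)%N) ->
  exists kappa : nat -> nat, {homo kappa : i j / (i <= j)%N} /\
    forall j i, (n j <= i < n j.+1)%N -> kappa i = j.
Proof.
move=> nS; have nlt : {homo n : i j / (i < j)%N} by apply: homo_ltn => // i j k; exact: ltn_trans.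
have nN i : exists k, (i < n k.+1)%N.
  exists i; elim: i => [|i IH]; first exact: leq_ltn_trans (nS 0%N).
  exact: leq_ltn_trans IH (nS _).
exists (fun i => ex_minn (nN i)); split=> [i j ij|j i /andP[nji inj]].
  case: ex_minnP => m _ mmin; case: ex_minnP => m' jm' _.
  exact/mmin/leq_ltn_trans/jm'.
case: ex_minnP => m im /(_ j inj) mj; apply/eqP; rewrite eqn_leq mj leqNgt /=.
apply/negP; rewrite -ltnS => mj'; have := leq_ltn_trans nji im.
rewrite ltnNge => /negP; apply.
by move: mj'; rewrite ltnS leq_eqVlt => /predU1P[->//|/nlt/ltnW].
Qed.

Section GoodCase.
Context (R : realType) (X : completeNormedModType R) (e : nat -> X).
Context (be : schauder_basis e) (K L : R) (K0 : 0 <= K) (L0 : 0 <= L).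
Context (eK : forall p n (a : nat -> R), (p <= n)%N ->
  `|\sum_(i < p) a i *: e i| <= K * `|\sum_(i < n) a i *: e i|).
Context (y : nat -> X) (M : R) (yM : forall k, `|y k| <= M).
Context (yL : forall f p n (a : nat -> R), increasing_seq f ->
  `|\sum_(p <= i < n) a i| <= L * `|\sum_(i < n) a i *: y (f i)|).
Context (C : R) (C0 : 0 <= C).
Context (yC : forall (k : nat -> nat) n (a : nat -> R),
  {homo k : i j / (i <= j)%N} ->
  `|\sum_(i < n) a i *: y (k i)| <= C * `|\sum_(i < n) a i *: e i|).
Context (Le : R) (Le0 : 0 <= Le) (b : nat -> R) (sigma beta : R).
Context (lim_b : limit_coefficients be K Le y b sigma).

Lemma complemented_of_cluster_neq : beta != sigma ->
  (forall N (eta : R), 0 < eta -> exists2 n, (N <= n)%N & `|\sum_(i < n) b i - beta| < eta) ->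
  exists f, increasing_seq f /\ complemented (closed_span (y \o f)).
Proof.
move=> bs bcl; pose g0 := sigma - beta.
have g00 : g0 != 0 by rewrite subr_eq0 eq_sym.
(* In [CT] below, [1 + K] pays for deleting the coordinates before [n 0]. In [D], [CT * K] bounds
   the norm of [T] and [c * 2 * M] the scalar errors, both those accumulated in [q] and the one left
   on [w k]. *)
pose c := `|g0^-1|; have c0 : 0 <= c by exact: normr_ge0.
have M0 : 0 <= M by exact: le_trans (yM 0%N).
pose CT := c * (C * (1 + K)); have CT0 : 0 <= CT by rewrite !mulr_ge0// addr_ge0.
pose D := CT * K + c * 2 * M + 1.
have D0 : 0 < D.
  apply: ltr_wpDl => //; apply: addr_ge0; first exact: mulr_ge0.
  by apply: mulr_ge0 => //; apply: mulr_ge0.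
pose delta := (12 * (L + 1))^-1 : R.
have delta0 : 0 < delta by rewrite invr_gt0 mulr_gt0// ltr_wpDl.
have Ldelta : 12 * L * delta <= 1.
  by rewrite ler_pdivrMr ?mul1r ?mulr_gt0 ?ltr_wpDl//; lra.
pose eps k : R := delta / D * 2^-1 ^+ k.
have eps0 k : 0 < eps k by rewrite mulr_gt0 ?exprn_gt0 ?invr_gt0// divr_gt0.
have epsS k : eps k.+1 <= eps k.
  apply: ler_wpM2l; first by apply/ltW/divr_gt0.
  by rewrite exprS ler_piMl ?exprn_ge0 ?invr_ge0// invf_le1// ler1n.
have Deps k : D * eps k = delta * 2^-1 ^+ k.
  by rewrite /eps mulrA [D * _]mulrC divfK// gt_eqF.
have bcl' (m N : nat) (eta : R) : 0 < eta -> exists n,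
    [/\ (N <= n)%N, `|\sum_(i < n) b i - beta| < eta & True].
  by move=> /(bcl N)[n Nn nb]; exists n.
have [n [f [nS fi _ nb /choice[w /choice[t]]]]] := gliding_hump K0 Le0 lim_b bcl' eps0.
move=> /all_and3[wt yw ts].
exists f; split=> //.
have [kappa [kle kE]] := block_index nS.
pose g i := if (i < n 0)%N then 0 else g0^-1 *: y (f (kappa i)).
have fle : {homo f : i j / (i <= j)%N} by move=> i j; rewrite -leEnat fi.
have gC m (a : nat -> R) :
    `|\sum_(i < m) a i *: g i| <= CT * `|\sum_(i < m) a i *: e i|.
  pose a' i := if (i < n 0)%N then 0 else a i.
  have -> : \sum_(i < m) a i *: g i = g0^-1 *: \sum_(i < m) a' i *: y (f (kappa i)).
    rewrite scaler_sumr; apply: eq_bigr => i _; rewrite /g /a'.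
    by case: ifP; rewrite ?scaler0 ?scale0r ?scaler0// !scalerA mulrC.
  rewrite normrZ /CT -!mulrA ler_wpM2l//.
  apply: le_trans (@yC (f \o kappa) _ _ _) _; first by move=> i j ij; apply/fle/kle.
  rewrite ler_wpM2l//.
  have [mn|nm] := leqP m (n 0%N).
    rewrite big1 ?normr0 ?mulr_ge0// ?addr_ge0// => i _.
    by rewrite /a' (leq_trans (ltn_ord i) mn) scale0r.
  rewrite (@sum_ord_behead _ (fun i => a' i *: e i) (n 0%N)) ?(ltnW nm)//; last first.
    by move=> i i0; rewrite /a' i0 scale0r.
  have -> : \sum_(n 0 <= i < m) a' i *: e i =
      \sum_(i < m) a i *: e i - \sum_(i < n 0) a i *: e i.
    rewrite -!(big_mkord xpredT (fun i => a i *: e i)).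
    rewrite (@big_cat_nat _ _ _ (n 0%N) 0 m)//=; last exact: ltnW.
    rewrite [RHS]addrC addKr; apply: eq_big_nat => i /andP[n0i _].
    by rewrite /a' ltnNge n0i.
  apply: le_trans (ler_normB _ _) _; rewrite mulrDl mul1r lerD2l.
  by apply: eK; exact: ltnW.
have [T [TC Te Tg]] := basis_operator be eK CT0 gC.
have Tsum (a : nat -> R) p q : T (\sum_(p <= i < q) a i *: e i) = \sum_(p <= i < q) a i *: g i.
  by rewrite linear_sum/=; apply: eq_bigr => i _; rewrite linearZ/= Te.
have Tblock j v s : block e (n j) (n j.+1) v s -> T v = (g0^-1 * s) *: y (f j).
  move=> [a -> ->]; rewrite Tsum mulr_sumr scaler_suml; apply: eq_big_nat => i /andP[ji ij].
  have n0i : (n 0 <= i)%N.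
    by apply: leq_trans ji; elim: j {ij} => // j IH; apply: leq_trans IH (ltnW (nS j)).
  by rewrite /g ltnNge n0i/= (kE j) ?ji// scalerA mulrC.
pose S m := \sum_(i < m) b i.
have TB k : T (\sum_(i < n k) b i *: e i) =
    \sum_(j < k) (g0^-1 * (S (n j.+1) - S (n j))) *: y (f j).
  elim: k => [|k IH].
    rewrite big_ord0 -(big_mkord xpredT (fun i => b i *: e i)) Tsum big_nat big1// => i /andP[_ i0].
    by rewrite /g i0 scaler0.
  rewrite big_ord_recr/= -IH -(Tblock k (\sum_(n k <= i < n k.+1) b i *: e i)).
    rewrite -linearD/= -!(big_mkord xpredT (fun i => b i *: e i)) -big_cat_nat//=.
    exact: ltnW.
  exists b => //; apply/eqP; rewrite subr_eq addrC /S -!(big_mkord xpredT b).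
  by rewrite -big_cat_nat//= ltnW.
apply: (complemented_closed_span TC).
  move=> x; apply: closed_span_cvg_sum (Tg x) => i; rewrite /g.
  case: ifP => _; first exact: closed_span0.
  rewrite -[_ *: _]addr0; apply: closed_span_linear; last exact: closed_span0.
  exact: (@closed_span_elt _ _ (y \o f)).
(* [q] collects the images of the blocks of [b] between cuts; [r] holds the deviation of the factor
   on [w k] from 1 and the image of the approximation error. *)
pose q j := - (g0^-1 * (S (n j.+1) - S (n j))) *: y (f j).
pose r k := (1 - g0^-1 * t k) *: y (f k) - T (y (f k) - (\sum_(i < n k) b i *: e i + w k)).
apply: (@small_perturbation _ _ (y \o f)
  (fun k => (y \o f) k - T ((y \o f) k)) q r L delta) => //.
- by move=> p m a; apply: yL.
- exact: ltW.
- move=> j; rewrite /q normrZ normrN normrM -Deps.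
  have h1 : `|S (n j.+1) - S (n j)| <= 2 * eps j.
    have := nb j; have := nb j.+1; have := epsS j; rewrite -/(S _) -/(S _).
    rewrite !ltr_norml ler_norml; move: (S (n j.+1)) (S (n j)) => ? ?; lra.
  apply: (@le_trans _ _ (c * (2 * eps j) * M)).
    by apply: ler_pM => //; apply: ler_wpM2l.
  have -> : c * (2 * eps j) * M = c * 2 * M * eps j by ring.
  apply: ler_wpM2r; first exact: ltW.
  by have := mulr_ge0 CT0 K0; rewrite /D; lra.
- move=> k; rewrite -Deps /r.
  have h1 : `|g0 - t k| <= 2 * eps k.
    have := nb k; have := ts k; rewrite /g0 -/(S _).
    rewrite !ltr_norml ler_norml; move: (S (n k)) => ?; lra.
  have h2 : `|(1 - g0^-1 * t k) *: y (f k)| <= c * 2 * M * eps k.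
    rewrite normrZ -[X in `|X - _|](mulVf g00) -mulrBr normrM -/c.
    have -> : c * 2 * M * eps k = c * (2 * eps k) * M by ring.
    by apply: ler_pM => //; [exact: mulr_ge0|exact: ler_wpM2l].
  have h3 := TC (y (f k) - (\sum_(i < n k) b i *: e i + w k)).
  apply: le_trans (ler_normB _ _) _; apply: le_trans (lerD h2 h3) _.
  have h4 : CT * K * `|y (f k) - (\sum_(i < n k) b i *: e i + w k)| <= CT * K * eps k.
    by apply: ler_wpM2l; [exact: mulr_ge0|exact/ltW/yw].
  have := eps0 k; rewrite /D; lra.
move=> k; rewrite /r /= [T (_ - _)]linearB [T (_ + _)]linearD/= (TB k) (Tblock k _ _ (wt k)).
rewrite /q (eq_bigr _ (fun j _ => scaleNr _ _)) sumrN scalerBl scale1r.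
suff H (u v A p : X) : u - v = - A + (u - p - (v - (A + p))) by exact: H.
by rewrite opprB [A + p]addrC -[p + A - v]addrA subrKA addrCA addKr.
Qed.
End GoodCase.

(** * Convergent coefficient sums *)

Lemma sum_nat_double (V : nmodType) (F : nat -> V) n :
  \sum_(0 <= j < n.*2) F j = \sum_(0 <= k < n) (F k.*2 + F k.*2.+1).
Proof.
elim: n => [|n IH]; first by rewrite !big_geq.
by rewrite doubleS !big_nat_recr//= IH addrA.
Qed.

Lemma sum_nat_divmod (V : nmodType) (F : nat -> V) m n :
  \sum_(0 <= p < m * n) F p =
  \sum_(0 <= i < m) \sum_(0 <= k < n) F (i * n + k)%N.
Proof.
rewrite sum_nat_mul; apply: eq_bigr => i _.
rewrite -{1}[(i * n)%N]add0n big_addn mulSn addnK.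
by apply: eq_bigr => k _; rewrite addnC.
Qed.

Lemma sum_by_parts (R : nzRingType) (V : lmodType R) (a : nat -> R) (v : nat -> V) m :
  \sum_(0 <= i < m) a i *: (\sum_(0 <= j < i.+1) v j) =
  \sum_(0 <= j < m) (\sum_(j <= i < m) a i) *: v j.
Proof.
elim: m => [|m IH]; first by rewrite !big_geq.
rewrite big_nat_recr//= IH [in RHS]big_nat_recr//= big_nat1.
rewrite big_nat_recr//= scalerDr addrA; congr (_ + _).
rewrite scaler_sumr -big_split/=; apply: eq_big_nat => j /andP[_ jm].
by rewrite (big_nat_recr m j)//= ?scalerDl// ltnW.
Qed.

Section ConvergentCoefficientSums.
Context (R : realType) (X : normedModType R) (e y : nat -> X).
Context (Cs C Cm : R) (Cs0 : 0 <= Cs) (C0 : 0 <= C) (Cm0 : 0 <= Cm).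
Context (scale_blocks : forall (n : nat -> nat) (v : nat -> X) (t th : nat -> R) J,
  (forall j, (n j <= n j.+1)%N) -> (forall j, block e (n j) (n j.+1) (v j) (t j)) ->
  (forall j, 0 <= th j <= 1) ->
  `|\sum_(0 <= j < J) th j *: v j| <=
  Cs * (`|\sum_(0 <= j < J) v j| + \sum_(0 <= j < J) `|t j|)).
Context (yC : forall (k : nat -> nat) n (a : nat -> R),
  {homo k : i j / (i <= j)%N} ->
  `|\sum_(i < n) a i *: y (k i)| <= C * `|\sum_(i < n) a i *: e i|).
Context (ym : forall (k f : nat -> nat) n (a : nat -> R),
  {homo k : i j / (i <= j)%N} -> {homo f : i j / (i < j)%N} ->
  `|\sum_(i < n) a i *: y (k i)| <= Cm * `|\sum_(i < n) a i *: y (f i)|).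
Context (small : forall eps : R, 0 < eps -> exists (m : nat) (c : nat -> R),
  [/\ forall i, 0 <= c i, \sum_(i < m) c i = 1 &
    `|\sum_(i < m) c i *: (e i.*2 - e i.*2.+1)| < eps]).
Context (n : nat -> nat) (b : nat -> R) (sigma : R) (w : nat -> X) (t : nat -> R).
Context (nS : forall k, (n k < n k.+1)%N).
Context (wt : forall k, block e (n k) (n k.+1) (w k) (t k)).

Let S k := \sum_(i < k) b i.
Let B k := \sum_(i < k) b i *: e i.
Let h k : R := 2^-1 ^+ k.

Context (Sn : forall k, `|S (n k) - sigma| < h k).
Context (yw : forall k, `|y k - (B (n k) + w k)| < h k).
Context (ts : forall k, `|S (n k) + t k - sigma| < h k).

Let h_le i j : (i <= j)%N -> h j <= h i.
Proof.
by move=> ij; apply: ler_wiXn2l => //; rewrite ?invr_ge0// invf_le1// ler1n.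
Qed.

Let h0 k : 0 <= h k.
Proof. by rewrite exprn_ge0// invr_ge0. Qed.

Let nmono : {homo n : i j / (i <= j)%N}.
Proof. by apply: homo_leq => // [i j k|i]; [exact: leq_trans|exact: ltnW]. Qed.

Let B_block k : B (n k.+1) = B (n k) + \sum_(n k <= i < n k.+1) b i *: e i.
Proof. by rewrite /B -!(big_mkord xpredT (fun i => b i *: e i)) -big_cat_nat//= ltnW. Qed.

Let S_block k : S (n k.+1) = S (n k) + \sum_(n k <= i < n k.+1) b i.
Proof. by rewrite /S -!(big_mkord xpredT b) -big_cat_nat//= ltnW. Qed.

(* On [n (2j), n (2j+1)) the difference y_{2j} - y_{2j+1} has coefficient sum
   close to 0; suppressing these blocks leaves the w_{2j+1}. *)
Lemma small_convex_tails (eps : R) : 0 < eps -> exists M (c : nat -> R),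
  [/\ forall k, 0 <= c k, \sum_(0 <= k < M) c k = 1 &
    forall o, `|\sum_(0 <= k < M) c k *: w (o.*2 + k.*2.+1)%N| <= eps + 6 * Cs * h o].
Proof.
move=> eps0; have CC : 0 < Cs * C + 1 by rewrite ltr_wpDl// mulr_ge0.
have [M [c [c0 c1 cs]]] := small (divr_gt0 eps0 CC).
(* The weights are fixed before [o], so they serve at all positions. *)
exists M, c; split=> // [|o]; first by rewrite big_mkord.
(* In a difference of consecutive terms [B] cancels except for the block of [b] between the two
   cuts, which joins the even term. The factors [th] delete the even blocks. *)
pose v j := if odd j then - (c j./2 *: w (o.*2 + j)%N)
  else c j./2 *: (w (o.*2 + j)%N - \sum_(n (o.*2 + j) <= i < n (o.*2 + j).+1) b i *: e i).
pose s j := if odd j then - (c j./2 * t (o.*2 + j)%N)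
  else c j./2 * (t (o.*2 + j)%N - \sum_(n (o.*2 + j) <= i < n (o.*2 + j).+1) b i).
pose th j : R := (odd j)%:R.
have := @scale_blocks (fun j => n (o.*2 + j)) v s th M.*2 _ _ _.
have -> : \sum_(0 <= j < M.*2) th j *: v j = - \sum_(0 <= k < M) c k *: w (o.*2 + k.*2.+1)%N.
  rewrite sum_nat_double -sumrN; apply: eq_bigr => k _.
  by rewrite /th /v/= odd_double/= scale0r add0r scale1r uphalf_double.
rewrite normrN => H; apply: le_trans (H _ _ _) _.
- by move=> j; rewrite addnS ltnW.
- move=> j; rewrite addnS /v /s; case: ifP => _.
    by rewrite -scaleNr -mulNr; apply: blockZ.
  by apply/blockZ/blockB => //; exact: block_sum.
- by move=> j; rewrite /th; case: odd; rewrite ?lexx ?ler01.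
have idx k : (o <= o.*2 + k.*2)%N /\ (o <= o.*2 + k.*2.+1)%N.
  by rewrite -addnn -!addnA !leq_addr.
have cv : `|\sum_(0 <= j < M.*2) v j| <= C * (eps / (Cs * C + 1)) + 2 * h o.
  pose d k := y (o.*2 + k.*2)%N - y (o.*2 + k.*2.+1)%N.
  have -> : \sum_(0 <= j < M.*2) v j = \sum_(0 <= k < M) c k *: d k +
      \sum_(0 <= k < M) c k *:
        ((y (o.*2 + k.*2.+1)%N - (B (n (o.*2 + k.*2.+1)%N) + w (o.*2 + k.*2.+1)%N))
         - (y (o.*2 + k.*2)%N - (B (n (o.*2 + k.*2)%N) + w (o.*2 + k.*2)%N))).
    rewrite sum_nat_double -big_split/=; apply: eq_bigr => k _.
    rewrite /v/= odd_double/= doubleK uphalf_double -scalerN -!scalerDr; congr (_ *: _).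
    rewrite /d !addnS B_block.
    suff H' (y1 y2 w1 w2 B1 b1 : X) : w1 - b1 - w2 =
      y1 - y2 + (y2 - (B1 + b1 + w2) - (y1 - (B1 + w1))) by exact: H'.
    rewrite addrA subrKA opprB [RHS]addrC subrKA -[B1 + b1 + w2]addrA.
    by rewrite opprD addrACA subrr add0r opprD addrA.
  apply: le_trans (ler_normD _ _) _; apply: lerD.
    pose a i := if odd i then - c i./2 else c i./2.
    have aE (V : lmodType R) (g : nat -> V) : \sum_(i < M.*2) a i *: g i =
        \sum_(i < M) c i *: (g i.*2 - g i.*2.+1).
      rewrite -(big_mkord xpredT (fun i => a i *: g i)) sum_nat_double big_mkord.
      apply: eq_bigr => k _.
      by rewrite /a/= odd_double/= doubleK uphalf_double scaleNr scalerBr.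
    have := @yC (fun i => o.*2 + i)%N M.*2 a _.
    rewrite (aE _ (fun i => y (o.*2 + i)%N)) aE big_mkord => H'.
    apply: le_trans (H' _) _; first by move=> i j; rewrite leq_add2l.
    by rewrite ler_wpM2l// ltW.
  apply: le_trans (ler_norm_sum _ _ _) _.
  apply: (@le_trans _ _ (\sum_(0 <= k < M) c k * (2 * h o))).
    apply: ler_sum => k _; rewrite normrZ ger0_norm// ler_wpM2l//.
    apply: le_trans (ler_normB _ _) _; rewrite mulr_natl mulr2n; have [i1 i2] := idx k.
    by apply: lerD; [apply: le_trans (h_le i2)|apply: le_trans (h_le i1)]; exact/ltW/yw.
  by rewrite -mulr_suml [X in X * _](_ : _ = 1) ?mul1r// big_mkord.
have sv : \sum_(0 <= j < M.*2) `|s j| <= 4 * h o.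
  rewrite sum_nat_double; apply: (@le_trans _ _ (\sum_(0 <= k < M) c k * (4 * h o))); last first.
    by rewrite -mulr_suml [X in X * _](_ : _ = 1) ?mul1r// big_mkord.
  apply: ler_sum => k _; rewrite /s/= odd_double/= doubleK uphalf_double normrN !normrM ger0_norm//.
  rewrite -mulrDr ler_wpM2l//; have [i1 i2] := idx k.
  have := S_block (o.*2 + k.*2); rewrite -addnS.
  have := h_le i1; have := h_le i2.
  have /ltW := Sn (o.*2 + k.*2.+1); have /ltW := ts (o.*2 + k.*2.+1).
  have /ltW := ts (o.*2 + k.*2).
  set A := \sum_(_ <= i < _) _; set s1 := S _; set s2 := S (n (_ + _.+1)).
  rewrite !ler_norml => /andP[? ?] /andP[? ?] /andP[? ?] ? ? s2E.
  have e1 : `|t (o.*2 + k.*2) - A| <= 2 * h o by rewrite ler_norml; apply/andP; split; lra.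
  have e2 : `|t (o.*2 + k.*2.+1)| <= 2 * h o by rewrite ler_norml; apply/andP; split; lra.
  by apply: le_trans (lerD e1 e2) _; lra.
have h1 : Cs * (C * (eps / (Cs * C + 1))) <= eps.
  rewrite mulrA mulrCA; apply: ler_piMr; first exact: ltW.
  by rewrite ler_pdivrMr// mul1r lerDl.
(* The 6 is 2 from replacing [y] by its blocks and 4 from the coefficient sums. *)
have := ler_wpM2l Cs0 (lerD cv sv); lra.
Qed.

(* Averaging y over blocks kills the w-parts and leaves averages of the B (n k). *)
Lemma sum_le_of_partial_sums m (al : nat -> R) (D : R) K0 :
  (forall g : nat -> nat, (forall i, (K0 <= g i)%N) ->
     {homo g : i j / (i < j)%N} ->
     `|\sum_(i < m) al i *: B (n (g i))| <= D) ->
  `|\sum_(i < m) al i *: y i| <= Cm * D.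
Proof.
move=> HD; pose A := \sum_(i < m) `|al i|.
have A0 : 0 <= A by exact: sumr_ge0.
have CA : 0 < Cm * A + 1 by rewrite ltr_wpDl// mulr_ge0.
suff H (eps : R) : 0 < eps -> `|\sum_(i < m) al i *: y i| <= Cm * (D + A * eps).
  apply/ler_addgt0Pr => eps eps0; apply: le_trans (H _ (divr_gt0 eps0 CA)) _.
  rewrite mulrDr lerD2l 2!mulrA ler_pdivrMr// mulrC ler_wpM2l ?(ltW eps0)//.
  by rewrite lerDl.
move=> eps0; have eps2 : 0 < eps / 2 by rewrite divr_gt0.
have [M [c [c0 c1 cw]]] := small_convex_tails eps2.
have M0 : (0 < M)%N.
  by case: M c1 {cw} => // /eqP; rewrite big_geq// eq_sym oner_eq0.
have [K1 [K01 hK1]] : exists K1, (K0 <= K1)%N /\ (6 * Cs + 1) * h K1 <= eps / 2.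
  have : geometric (6 * Cs + 1) (2^-1 : R) @ \oo --> 0.
    by apply: cvg_geometric; rewrite ger0_norm ?invr_ge0// invf_lt1// ltr1n.
  move=> /cvgrPdist_lt/(_ _ eps2)[N _ HN]; exists (maxn K0 N).
  split; first exact: leq_maxl.
  have := HN _ (leq_maxr K0 N); rewrite /= sub0r normrN => /ltW.
  by apply: le_trans; exact: ler_norm.
(* Each [y i] is split into [M] copies weighted by [c]. Merging along [p %/ M] restores the original
   sum, while [pi] puts the copies at far odd positions, as [small_convex_tails] requires. *)
pose a p := al (p %/ M)%N * c (p %% M)%N.
pose pi p := (K1 + p).*2.+1.
have aE (V : lmodType R) (g : nat -> nat -> V) :
    \sum_(p < m * M) a p *: g (p %/ M)%N (p %% M)%N =
    \sum_(i < m) al i *: \sum_(0 <= k < M) c k *: g i k.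
  rewrite -(big_mkord xpredT (fun p => a p *: g (p %/ M)%N (p %% M)%N)).
  rewrite sum_nat_divmod big_mkord; apply: eq_bigr => i _.
  rewrite scaler_sumr; apply: eq_big_nat => k /andP[_ kM].
  by rewrite /a divnMDl// divn_small// addn0 modnMDl modn_small// scalerA.
have := @ym (fun p => p %/ M)%N pi (m * M) a _ _.
rewrite (aE _ (fun i k => y i)) => H.
have -> : \sum_(i < m) al i *: y i = \sum_(i < m) al i *: \sum_(0 <= k < M) c k *: y i.
  by apply: eq_bigr => i _; rewrite -scaler_suml c1 scale1r.
apply: le_trans (H _ _) _.
- by move=> i j; exact: leq_div2r.
- by move=> i j ij; rewrite /pi ltnS ltn_double ltn_add2l.
apply: ler_wpM2l => //.
pose idx i k := (K1 + (i * M + k)).*2.+1.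
have idxE i k : idx i k = ((K1 + i * M).*2 + k.*2.+1)%N.
  by rewrite /idx addnA doubleD addnS.
have K1_idx i k : (K1 <= idx i k)%N by rewrite /idx leqW// -addnn -addnA leq_addr.
have -> : \sum_(p < m * M) a p *: y (pi p) =
    \sum_(i < m) al i *: \sum_(0 <= k < M) c k *: y (idx i k).
  rewrite -(aE _ (fun i k => y (idx i k))); apply: eq_bigr => p _.
  by rewrite /idx /pi -divn_eq.
(* For a fixed offset [k] the [B] terms run along an increasing sequence in [i], so [D] bounds them;
   the [w] terms are instead grouped over [k], where the weights make them small. *)
have -> : \sum_(i < m) al i *: \sum_(0 <= k < M) c k *: y (idx i k) =
    \sum_(0 <= k < M) c k *: \sum_(i < m) al i *: B (n (idx i k)) +
    \sum_(i < m) al i *: (\sum_(0 <= k < M) c k *: w (idx i k) +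
      \sum_(0 <= k < M) c k *: (y (idx i k) - (B (n (idx i k)) + w (idx i k)))).
  under [X in _ = X + _]eq_bigr do rewrite scaler_sumr.
  rewrite exchange_big/= -big_split/=; apply: eq_bigr => i _.
  under [X in _ = X + _]eq_bigr do rewrite scalerA mulrC -scalerA.
  rewrite -scaler_sumr -scalerDr; congr (_ *: _).
  rewrite -!big_split/=; apply: eq_bigr => k _; rewrite -!scalerDr; congr (_ *: _).
  by rewrite addrA addrC subrK.
apply: le_trans (ler_normD _ _) _; apply: lerD.
  apply: le_trans (ler_norm_sum _ _ _) _.
  apply: (@le_trans _ _ (\sum_(0 <= k < M) c k * D)); last by rewrite -mulr_suml c1 mul1r.
  apply: ler_sum => k _; rewrite normrZ ger0_norm//; apply: ler_wpM2l => //.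
  apply: (HD (fun i => idx i k)) => [i|i j ij].
    exact: leq_trans K01 (K1_idx i k).
  by rewrite /idx ltnS ltn_double ltn_add2l ltn_add2r ltn_mul2r M0.
apply: le_trans (ler_norm_sum _ _ _) _; rewrite /A mulr_suml; apply: ler_sum => i _.
rewrite normrZ; apply: ler_wpM2l => //; apply: le_trans (ler_normD _ _) _.
have -> : eps = (eps / 2 + 6 * Cs * h K1) + h K1 + (eps / 2 - (6 * Cs + 1) * h K1) by field.
apply: ler_wpDr; first by rewrite subr_ge0.
apply: lerD.
  have := cw (K1 + i * M)%N.
  rewrite (eq_bigr (fun k => c k *: w (idx i k))); last first.
    by move=> k _; rewrite idxE.
  move=> /le_trans; apply; rewrite lerD2l ler_wpM2l ?mulr_ge0//; apply: h_le; exact: leq_addr.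
apply: le_trans (ler_norm_sum _ _ _) _.
apply: (@le_trans _ _ (\sum_(0 <= k < M) c k * h K1)); last by rewrite -mulr_suml c1 mul1r.
apply: ler_sum => k _; rewrite normrZ ger0_norm//; apply: ler_wpM2l => //.
exact: le_trans (ltW (yw _)) (h_le (K1_idx i k)).
Qed.

Context (MB : R) (BM : forall k, `|B k| <= MB).

(** By Abel summation the sum runs over successive blocks of [b], with the tails of [al] as
    coefficients. Their positive and negative parts, divided by [tau], are admissible factors for
    [scale_blocks]; hence the 2. *)
Lemma sum_partial_sums_le m (al : nat -> R) (tau : R) (g : nat -> nat) :
  {homo g : i j / (i < j)%N} ->
  (forall l, `|\sum_(l <= i < m) al i| <= tau) ->
  `|\sum_(i < m) al i *: B (n (g i))| <= tau * (2 * Cs * (MB + (`|sigma| + 5))).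
Proof.
move=> gi altau.
have tau0 : 0 <= tau by apply: le_trans (altau 0%N).
pose p i := if i is i'.+1 then n (g i') else 0%N.
pose v i := \sum_(p i <= l < p i.+1) b l *: e l.
pose s i := \sum_(p i <= l < p i.+1) b l.
pose A i := \sum_(i <= l < m) al l.
have pS i : (p i <= p i.+1)%N.
  by case: i => //= i; apply/nmono/ltnW/gi.
have Bp i : B (p i.+1) = B (p i) + v i.
  by rewrite /B /v -!(big_mkord xpredT (fun i => b i *: e i)) -big_cat_nat.
have Sp i : S (p i.+1) = S (p i) + s i.
  by rewrite /S /s -!(big_mkord xpredT b) -big_cat_nat.
have BpE i : B (p i.+1) = \sum_(0 <= j < i.+1) v j.
  elim: i => [|i IH]; first by rewrite big_nat1 Bp /B big_ord0 add0r.
  by rewrite big_nat_recr//= -IH -Bp.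
have -> : \sum_(i < m) al i *: B (n (g i)) = \sum_(0 <= i < m) A i *: v i.
  by rewrite -sum_by_parts big_mkord; apply: eq_bigr => i _; rewrite -BpE.
have Bm : `|\sum_(0 <= i < m) v i| <= MB.
  have -> : \sum_(0 <= i < m) v i = B (p m); last exact: BM.
  elim: m {altau A} => [|m IH]; first by rewrite big_geq// /B big_ord0.
  by rewrite big_nat_recr//= IH Bp.
have gge i : (i <= g i)%N.
  by elim: i => // i IH; apply: leq_ltn_trans IH (gi _ _ _).
(* The first block sum is within 1 of [sigma], and the later ones, at most [2 * h i], add up to at
   most 4. *)
have sm : \sum_(0 <= i < m) `|s i| <= `|sigma| + 5.
  case: (m) => [|m']; first by rewrite big_geq// addr_ge0.
  have s0 : `|s 0%N| <= `|sigma| + 1.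
    have -> : s 0%N = (S (n (g 0%N)) - sigma) + sigma.
      by rewrite subrK -[n (g 0%N)]/(p 1) Sp /S big_ord0 add0r.
    apply: le_trans (ler_normD _ _) _; rewrite addrC lerD2l.
    by apply: le_trans (ltW (Sn _)) _; apply: (h_le (leq0n _)).
  have si i : `|s i.+1| <= 2 * h i.
    have -> : s i.+1 = (S (n (g i.+1)) - sigma) - (S (n (g i)) - sigma).
      rewrite opprB addrA subrK -[n (g i.+1)]/(p i.+2) Sp.
      by rewrite -[n (g i)]/(p i.+1) addrC addKr.
    apply: le_trans (ler_normB _ _) _; rewrite mulr_natl mulr2n.
    apply: lerD; apply: le_trans (ltW (Sn _)) (h_le _) => //.
    by apply: leq_trans (gge _); exact: leqnSn.
  rewrite big_nat_recl//.
  have := sum_half_expn_le R m'.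
  have : \sum_(0 <= i < m') `|s i.+1| <= 2 * \sum_(0 <= i < m') h i.
    by rewrite mulr_sumr; apply: ler_sum => i _; exact: si.
  rewrite /h; lra.
have [tau_eq0|tau_gt0] : tau = 0 \/ 0 < tau.
- by move: tau0; rewrite le_eqVlt => /predU1P[<-|]; [left|right].
- rewrite tau_eq0 mul0r big1 ?normr0// => i _.
  have := altau i; rewrite tau_eq0 normr_le0 => /eqP; rewrite -/(A i) => ->.
  by rewrite scale0r.
have half (Q : R -> R) : (forall i, 0 <= Q (A i) <= tau) ->
    `|\sum_(0 <= i < m) Q (A i) *: v i| <= tau * (Cs * (MB + (`|sigma| + 5))).
  move=> Q01.
  have := @scale_blocks p v s (fun i => Q (A i) / tau) m pS _ _.
  have -> : \sum_(0 <= i < m) (Q (A i) / tau) *: v i =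
      tau^-1 *: \sum_(0 <= i < m) Q (A i) *: v i.
    by rewrite scaler_sumr; apply: eq_bigr => i _; rewrite scalerA mulrC.
  rewrite normrZ gtr0_norm ?invr_gt0// => H.
  rewrite -ler_pdivrMl//; apply: le_trans (H _ _) _.
  - by move=> i; exact: block_sum.
  - move=> i; have /andP[q0 q1] := Q01 i.
    by rewrite divr_ge0//= ler_pdivrMr// mul1r.
  by rewrite ler_wpM2l//; exact: lerD.
have Atau i : - tau <= A i <= tau by rewrite -ler_norml; exact: altau.
have -> : \sum_(0 <= i < m) A i *: v i =
    \sum_(0 <= i < m) Num.max 0 (A i) *: v i - \sum_(0 <= i < m) Num.max 0 (- A i) *: v i.
  rewrite -sumrB; apply: eq_bigr => i _; rewrite -scalerBl; congr (_ *: _).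
  by rewrite !maxEle oppr_ge0; have [] := ltgtP 0 (A i); lra.
have h1 := half (fun x => Num.max 0 x) _.
have h2 := half (fun x => Num.max 0 (- x)) _.
apply: le_trans (ler_normB _ _) _; apply: le_trans (lerD (h1 _) (h2 _)) _.
- by move=> i; rewrite le_max lexx/= ge_max tau0; case/andP: (Atau i).
- by move=> i; rewrite le_max lexx/= ge_max tau0/= lerNl; case/andP: (Atau i).
by rewrite le_eqVlt; apply/orP; left; apply/eqP; ring.
Qed.

Definition tail_sup_const : R := Cm * (2 * Cs * (MB + (`|sigma| + 5))).

(** The supremum of the tail sums is the norm of the combination of the summing basis of c0 with
    coefficients [al]. *)
Lemma sum_le_tail_sup m (al : nat -> R) (tau : R) :
  (forall l, `|\sum_(l <= i < m) al i| <= tau) ->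
  `|\sum_(i < m) al i *: y i| <= tail_sup_const * tau.
Proof.
move=> altau; rewrite /tail_sup_const -mulrA [_ * tau]mulrC.
apply: (@sum_le_of_partial_sums m al _ 0%N) => g _ gi.
exact: sum_partial_sums_le.
Qed.

(** If [B] stayed near some [B m], the coefficients 1 and -1 in [sum_le_of_partial_sums], with all
    indices pushed far out, would bound [|y 0 - y 1|] by less than itself. *)
Lemma partial_sums_separated : y 0%N != y 1%N ->
  exists2 delta : R, 0 < delta & forall m N, exists2 k, (N <= k)%N & delta <= `|B k - B m|.
Proof.
move=> y01; apply: contrapT => H.
have Cm1 : 0 < Cm + 1 by rewrite ltr_wpDl.
pose delta := `|y 0%N - y 1%N| / (Cm + 1) / 2.
have d0 : 0 < delta by rewrite !divr_gt0// normr_gt0 subr_eq0.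
apply: H; exists (delta / 2) => [|m N]; first by rewrite divr_gt0.
apply: contrapT => H.
have near_ k : (N <= k)%N -> `|B k - B m| < delta / 2.
  by move=> Nk; rewrite ltNge; apply/negP => h'; apply: H; exists k.
pose al (i : nat) : R := if i is 0%N then 1 else -1.
have alE (V : lmodType R) (v : nat -> V) : \sum_(i < 2) al i *: v i = v 0%N - v 1%N.
  by rewrite !big_ord_recr big_ord0/= add0r scale1r scaleN1r.
have := @sum_le_of_partial_sums 2 al delta N; rewrite alE => H1.
suff /H1 : forall g : nat -> nat, (forall i, (N <= g i)%N) -> {homo g : i j / (i < j)%N} ->
    `|\sum_(i < 2) al i *: B (n (g i))| <= delta.
  have -> : `|y 0%N - y 1%N| = (Cm + 1) * delta * 2 by rewrite /delta; field; rewrite gt_eqF.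
  by have := mulr_ge0 Cm0 (ltW d0); rewrite mulrDl mul1r; lra.
move=> g gN gi; rewrite (alE _ (fun i => B (n (g i)))).
have nN i : (N <= n (g i))%N.
  by apply: leq_trans (gN i) _; elim: (g i) => // j IH; exact: leq_ltn_trans IH (nS j).
have := near_ _ (nN 0%N); have := near_ _ (nN 1%N).
have -> : B (n (g 0%N)) - B (n (g 1%N)) =
  (B (n (g 0%N)) - B m) - (B (n (g 1%N)) - B m) by rewrite opprB addrA subrK.
have := ler_normB (B (n (g 0%N)) - B m) (B (n (g 1%N)) - B m); lra.
Qed.

End ConvergentCoefficientSums.

(** * The projection when the coefficient sums converge *)

Section ConvergentCase.
Context (R : realType) (X : completeNormedModType R) (e : nat -> X).
Context (be : schauder_basis e) (K L : R) (K0 : 0 <= K) (L0 : 0 <= L).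
Context (eK : forall p n (a : nat -> R), (p <= n)%N ->
  `|\sum_(i < p) a i *: e i| <= K * `|\sum_(i < n) a i *: e i|).
Context (y : nat -> X) (M : R) (yM : forall k, `|y k| <= M).
Context (yL : forall f p n (a : nat -> R), increasing_seq f ->
  `|\sum_(p <= i < n) a i| <= L * `|\sum_(i < n) a i *: y (f i)|).
Context (Cs C Cm : R) (Cs0 : 0 <= Cs) (C0 : 0 <= C) (Cm0 : 0 <= Cm).
Context (scale_blocks : forall (n : nat -> nat) (v : nat -> X) (t th : nat -> R) J,
  (forall j, (n j <= n j.+1)%N) -> (forall j, block e (n j) (n j.+1) (v j) (t j)) ->
  (forall j, 0 <= th j <= 1) ->
  `|\sum_(0 <= j < J) th j *: v j| <=
  Cs * (`|\sum_(0 <= j < J) v j| + \sum_(0 <= j < J) `|t j|)).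
Context (yC : forall (k : nat -> nat) n (a : nat -> R),
  {homo k : i j / (i <= j)%N} ->
  `|\sum_(i < n) a i *: y (k i)| <= C * `|\sum_(i < n) a i *: e i|).
Context (ym : forall (k f : nat -> nat) n (a : nat -> R),
  {homo k : i j / (i <= j)%N} -> {homo f : i j / (i < j)%N} ->
  `|\sum_(i < n) a i *: y (k i)| <= Cm * `|\sum_(i < n) a i *: y (f i)|).
Context (small : forall eps : R, 0 < eps -> exists (m : nat) (c : nat -> R),
  [/\ forall i, 0 <= c i, \sum_(i < m) c i = 1 &
    `|\sum_(i < m) c i *: (e i.*2 - e i.*2.+1)| < eps]).
Context (yneq : forall i j, (i < j)%N -> y i != y j).
Context (Le : R) (Le0 : 0 <= Le) (b : nat -> R) (sigma : R).
Context (lim_b : limit_coefficients be K Le y b sigma).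
Context (sigmaE : forall eta : R, 0 < eta ->
  exists N, forall n, (N <= n)%N -> `|\sum_(i < n) b i - sigma| < eta).

Let B k := \sum_(i < k) b i *: e i.

Let half_gt0 k : 0 < (2^-1 : R) ^+ k.
Proof. by rewrite exprn_gt0// invr_gt0. Qed.

(** A preliminary gliding hump serves only to get estimates that survive a new choice of cuts: the
    separation concerns [B] alone, and [ym] carries the upper bound over to other subsequences. *)
Lemma convergent_case_estimates : exists (CU delta : R) (f : nat -> nat),
  [/\ 0 <= CU, 0 < delta,
    {homo f : i j / (i < j)%N},
    forall m (al : nat -> R) (tau : R), (forall l, `|\sum_(l <= i < m) al i| <= tau) ->
      `|\sum_(i < m) al i *: y (f i)| <= CU * tau &
    forall m N, exists2 k, (N <= k)%N & delta <= `|B k - B m|].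
Proof.
have M0 : 0 <= M by exact: le_trans (yM 0%N).
have clG (m N : nat) (eta : R) : 0 < eta -> exists n,
    [/\ (N <= n)%N, `|\sum_(i < n) b i - sigma| < eta & True].
  move=> /sigmaE[N' HN']; exists (maxn N N'); split=> //; first exact: leq_maxl.
  by apply: HN'; exact: leq_maxr.
have [n [f [nS fi _ nb /choice[w /choice[t]]]]] := gliding_hump K0 Le0 lim_b clG half_gt0.
move=> /all_and3[wt yw ts].
have flt : {homo f : i j / (i < j)%N} by move=> i j; rewrite (increasing_seq_ltE fi).
have fle : {homo f : i j / (i <= j)%N} by move=> i j; rewrite -leEnat fi.
have yC' (k : nat -> nat) m (a : nat -> R) : {homo k : i j / (i <= j)%N} ->
    `|\sum_(i < m) a i *: (y \o f) (k i)| <= C * `|\sum_(i < m) a i *: e i|.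
  by move=> ki; apply: (@yC (f \o k)) => i j ij; apply/fle/ki.
have ym' (k g : nat -> nat) m (a : nat -> R) :
    {homo k : i j / (i <= j)%N} -> {homo g : i j / (i < j)%N} ->
    `|\sum_(i < m) a i *: (y \o f) (k i)| <= Cm * `|\sum_(i < m) a i *: (y \o f) (g i)|.
  move=> ki gi; apply: (@ym (f \o k) (f \o g)) => i j ij; first exact/fle/ki.
  exact/flt/gi.
have BM k : `|B k| <= K * M by exact: (limit_partial_sum_bound eK K0 yM lim_b).
exists (tail_sup_const Cs Cm sigma (K * M)).
have [|delta d0 sep] := partial_sums_separated Cs0 C0 Cm0 scale_blocks yC' ym' small nS wt nb yw ts.
  by apply: yneq; apply: flt.
exists delta, f; split=> //.
- by rewrite /tail_sup_const !(mulr_ge0, addr_ge0).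
- move=> m al tau altau.
  exact: (sum_le_tail_sup Cs0 C0 Cm0 scale_blocks yC' ym' small nS wt nb yw ts BM altau).
Qed.

(** [T] reads the odd blocks through norming functionals and answers with the differences [u j] of
    the chosen terms. These have an upper c0-estimate, so a uniform bound on the functionals
    suffices. The image of [B (n k.*2.+2)] telescopes to [y' k]. *)
Lemma complemented_of_cvg :
  exists f, increasing_seq f /\ complemented (closed_span (y \o f)).
Proof.
have [CU [delta [f1 [CU0 d0 f1i U sep]]]] := convergent_case_estimates.
(* [2 * K] bounds the projection onto a block, [delta^-1] the functionals, and [Cm * CU] is the
   c0-constant of [u]. *)
pose CT := Cm * CU * (delta^-1 * (2 * K)).
have CT0 : 0 <= CT by rewrite !mulr_ge0// invr_ge0 ltW.
have CK1 : 0 < CT * K + 1 by rewrite ltr_wpDl// mulr_ge0.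
pose d := (12 * (L + 1))^-1 : R.
have dgt0 : 0 < d by rewrite invr_gt0 mulr_gt0// ltr_wpDl.
have Ld : 12 * L * d <= 1.
  by rewrite ler_pdivrMr ?mul1r ?mulr_gt0 ?ltr_wpDl//; lra.
pose eps k : R := d / (CT * K + 1) * 2^-1 ^+ k.
have eps0 k : 0 < eps k by rewrite mulr_gt0// divr_gt0.
have clG (m N : nat) (eta : R) : 0 < eta -> exists n,
    [/\ (N <= n)%N, `|\sum_(i < n) b i - sigma| < eta & delta <= `|B n - B m|].
  move=> /sigmaE[N' HN']; have [k Nk dk] := sep m (maxn N N').
  exists k; split=> //; first exact: leq_trans (leq_maxl _ _) Nk.
  by apply: HN'; exact: leq_trans (leq_maxr _ _) Nk.
have [n [f [nS fi nG _ /choice[w /choice[t]]]]] := gliding_hump K0 Le0 lim_b clG eps0.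
move=> /all_and3[wt yw _].
have flt : {homo f : i j / (i < j)%N} by move=> i j; rewrite (increasing_seq_ltE fi).
(* Even indices place each [w] in a block that [T] kills; starting at 2 leaves one odd block before
   the first term. *)
pose f' k := f k.*2.+2.
have f'lt : {homo f' : i j / (i < j)%N} by move=> i j ij; apply: flt; rewrite !ltnS ltn_double.
pose y' := y \o f'.
exists f'; split; first exact: increasing_seq_lt.
pose u j := y' j - (if j is j'.+1 then y' j' else 0).
have uE k : \sum_(0 <= j < k.+1) u j = y' k.
  elim: k => [|k IH]; first by rewrite big_nat1 /u subr0.
  by rewrite big_nat_recr//= IH /u addrC subrK.
have uC J (c : nat -> R) (tau : R) : 0 <= tau -> (forall j, (j < J)%N -> `|c j| <= tau) ->
    `|\sum_(0 <= j < J) c j *: u j| <= Cm * CU * tau.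
  move=> tau0; case: J => [|J] ctau; first by rewrite big_geq// normr0 !mulr_ge0.
  pose c' j := if (j < J.+1)%N then c j else 0.
  (* The tail sums of [al] are the values of [c'], so a sup bound on [c] becomes the tail hypothesis
     of [U]. *)
  pose al j := c' j - c' j.+1.
  have alE l : (l <= J.+1)%N -> \sum_(l <= i < J.+1) al i = c' l.
    have c'J : c' J.+1 = 0 by rewrite /c' ltnn.
    move=> /(telescope_sumr c'); rewrite c'J sub0r => h.
    rewrite -[RHS]opprK -h -sumrN.
    by apply: eq_bigr => i _; rewrite opprB.
  have -> : \sum_(0 <= j < J.+1) c j *: u j = \sum_(i < J.+1) al i *: y' i.
    rewrite -(big_mkord xpredT (fun i => al i *: y' i)).
    rewrite [RHS](eq_bigr (fun i => al i *: \sum_(0 <= j < i.+1) u j)); last first.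
      by move=> i _; rewrite uE.
    rewrite sum_by_parts; apply: eq_big_nat => j /andP[_ jJ].
    by rewrite alE ?(ltnW jJ)// /c' jJ.
  rewrite -mulrA; apply: le_trans (@ym f' f1 J.+1 al _ f1i) _.
    by apply: homo_leq => // [i j k|i]; [exact: leq_trans|apply/ltnW/f'lt].
  apply: ler_wpM2l => //; apply: U => l; have [lJ|Jl] := leqP l J.+1.
    by rewrite alE// /c'; case: ifP => [/ctau//|_]; rewrite normr0.
  by rewrite big_geq ?normr0// ltnW.
pose bb j := B (n j.*2.+2) - B (n j.*2.+1).
have /choice[psi psiP] : forall j, exists psi : X -> R,
    [/\ forall a x z, psi (a *: x + z) = a * psi x + psi z,
        forall x, `|psi x| <= delta^-1 * `|x| & psi (bb j) = 1].
  move=> j; have [psi [lin le1 nv]] := norming_functional (bb j).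
  have bj : delta <= `|bb j| by exact: nG.
  have bj0 : 0 < `|bb j| by exact: lt_le_trans bj.
  exists (fun x => psi x / `|bb j|); split.
  - by move=> a x z; rewrite lin mulrDl mulrA.
  - move=> x; rewrite normrM normfV normr_id mulrC; apply: ler_pM => //.
    by rewrite lef_pV2.
  - by rewrite nv divff// gt_eqF.
have psi0 j : psi j 0 = 0.
  by have [lin _ _] := psiP j; have := lin (-1) 0 0; rewrite scaler0 addr0 mulN1r addNr.
have psi_sum j p q (a : nat -> R) (v : nat -> X) :
    psi j (\sum_(p <= i < q) a i *: v i) = \sum_(p <= i < q) a i * psi j (v i).
  have [lin _ _] := psiP j.
  elim/big_ind2 : _ => [|s1 x1 s2 x2 <- <-|i _]; first exact: psi0.
    by rewrite -{1}[x1]scale1r lin mul1r.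
  by rewrite -[_ *: _]addr0 lin psi0 addr0.
have [kappa [_ kE]] := block_index nS.
have n0 k : (n 0 <= n k)%N.
  by elim: k => // k IH; apply: leq_trans IH (ltnW (nS k)).
pose g i := if (i < n 0)%N then 0 else
  if odd (kappa i) then psi (kappa i)./2 (e i) *: u (kappa i)./2 else 0.
have gblock k (a : nat -> R) : \sum_(n k <= i < n k.+1) a i *: g i =
    if odd k then psi k./2 (\sum_(n k <= i < n k.+1) a i *: e i) *: u k./2 else 0.
  transitivity (\sum_(n k <= i < n k.+1)
      if odd k then (a i * psi k./2 (e i)) *: u k./2 else 0).
    apply: eq_big_nat => i /andP[ki ik]; rewrite /g ltnNge (leq_trans (n0 k) ki)/=.
    by rewrite (kE k) ?ki//; case: ifP; rewrite ?scaler0// scalerA.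
  by case: ifP => _; [rewrite psi_sum scaler_suml|rewrite big1].
have gsum J (a : nat -> R) : \sum_(0 <= i < n J.*2) a i *: g i =
    \sum_(0 <= j < J)
      psi j (\sum_(n j.*2.+1 <= i < n j.*2.+2) a i *: e i) *: u j.
  have H k : \sum_(0 <= i < n k) a i *: g i =
      \sum_(0 <= l < k) \sum_(n l <= i < n l.+1) a i *: g i.
    elim: k => [|k IH].
      by rewrite [RHS]big_geq// big_nat big1// => i /andP[_ i0]; rewrite /g i0 scaler0.
    by rewrite big_nat_recr//= -IH -big_cat_nat//= ltnW.
  rewrite H sum_nat_double; apply: eq_bigr => j _.
  by rewrite !gblock/= odd_double/= add0r uphalf_double.
have gC m (a : nat -> R) :
    `|\sum_(i < m) a i *: g i| <= CT * `|\sum_(i < m) a i *: e i|.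
  pose a' i := if (i < m)%N then a i else 0.
  have mn : (m <= n m.*2)%N.
    have nid k : (k <= n k)%N by elim: k => // k IH; exact: leq_ltn_trans IH (nS k).
    by apply: leq_trans (nid m.*2); rewrite -addnn leq_addr.
  have a'E (v : nat -> X) : \sum_(i < n m.*2) a' i *: v i = \sum_(i < m) a i *: v i.
    rewrite (@sum_ord_trim _ (fun i => a' i *: v i) m)//.
      by apply: eq_bigr => i _; rewrite /a' ltn_ord.
    by move=> i /andP[mi _]; rewrite /a' ltnNge mi scale0r.
  rewrite -a'E -(big_mkord xpredT (fun i => a' i *: g i)) gsum -mulrA.
  apply: uC => [|j jm]; first by rewrite !mulr_ge0 ?invr_ge0// ltW.
  have [_ le1 _] := psiP j.
  apply: le_trans (le1 _) _; rewrite -mulrA ler_wpM2l ?invr_ge0 ?(ltW d0)//.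
  have nle : {homo n : i j / (i <= j)%N}.
    by apply: homo_leq => // [i l k|i]; [exact: leq_trans|exact: ltnW].
  have -> : \sum_(n j.*2.+1 <= i < n j.*2.+2) a' i *: e i =
      \sum_(i < n j.*2.+2) a' i *: e i - \sum_(i < n j.*2.+1) a' i *: e i.
    rewrite -!(big_mkord xpredT (fun i => a' i *: e i)).
    by rewrite (@big_cat_nat _ _ _ (n j.*2.+1) 0 (n j.*2.+2))//= ?nle// [RHS]addrC addKr.
  apply: le_trans (ler_normB _ _) _; rewrite -(a'E e) [2 * K]mulr_natl mulr2n mulrDl.
  by apply: lerD; apply: eK; apply: nle; rewrite -?doubleS ?leq_double// ltn_double.
have [T [TC Te Tg]] := basis_operator be eK CT0 gC.
have Tsum (a : nat -> R) p q : T (\sum_(p <= i < q) a i *: e i) = \sum_(p <= i < q) a i *: g i.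
  by rewrite linear_sum/=; apply: eq_bigr => i _; rewrite linearZ/= Te.
have TB k : T (B (n k.*2.+2)) = y' k.
  rewrite /B -(big_mkord xpredT (fun i => b i *: e i)) Tsum -doubleS gsum -uE.
  apply: eq_bigr => j _; have [_ _ p1] := psiP j.
  rewrite -[RHS]scale1r -p1; congr (psi j _ *: _).
  rewrite /bb /B -!(big_mkord xpredT (fun i => b i *: e i)).
  by rewrite (@big_cat_nat _ _ _ (n j.*2.+1) 0 (n j.*2.+2))//= ?(ltnW (nS _))// [RHS]addrC addKr.
have Tw k : T (w k.*2.+2) = 0.
  by have [a -> _] := wt k.*2.+2; rewrite Tsum gblock/= odd_double.
have yu j : closed_span y' (u j).
  rewrite /u; case: j => [|j]; first by rewrite subr0; exact: closed_span_elt.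
  by rewrite -scaleN1r addrC; apply: closed_span_linear; exact: closed_span_elt.
apply: (complemented_closed_span TC).
  move=> x; apply: closed_span_cvg_sum (Tg x) => i; rewrite /g.
  case: ifP => _; first exact: closed_span0.
  case: ifP => _; last exact: closed_span0.
  by rewrite -[_ *: _]addr0; apply: closed_span_linear; [exact: yu|exact: closed_span0].
pose r k := - T (y' k - (B (n k.*2.+2) + w k.*2.+2)).
apply: (@small_perturbation _ _ y' (fun k => y' k - T (y' k)) (fun=> 0) r L d) => //.
- by move=> p m a; apply: yL; exact: increasing_seq_lt.
- exact: ltW.
- by move=> j; rewrite normr0 mulr_ge0 ?(ltW dgt0) ?(ltW (half_gt0 _)).
- move=> k; rewrite /r normrN; apply: le_trans (TC _) _.
  apply: (@le_trans _ _ (CT * K * eps k.*2.+2)).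
    by apply: ler_wpM2l; [exact: mulr_ge0|exact/ltW/yw].
  rewrite /eps mulrA; apply: ler_pM.
  + by apply: mulr_ge0; [exact: mulr_ge0|exact/ltW/divr_gt0].
  + exact: ltW.
  + by rewrite mulrA ler_pdivrMr// mulrC ler_wpM2l ?(ltW dgt0)// lerDl.
  + by apply: ler_wiXn2l; rewrite ?invr_ge0// ?invf_le1// ?ler1n// 2?leqW// -addnn leq_addr.
move=> k; rewrite big1// add0r /r [T (_ - _)]linearB [T (_ + _)]linearD/= TB Tw addr0.
by rewrite opprB.
Qed.

End ConvergentCase.

(** * The theorem *)

(** A norming functional gives a rank one projection; for [y 0 = 0] the same formula is the zero
    operator. *)
Lemma complemented_constant (R : realType) (X : completeNormedModType R) (y : nat -> X) :
  (forall k, y k = y 0%N) -> complemented (closed_span y).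
Proof.
move=> yE; have [psi [lin le1 nv]] := norming_functional (y 0%N).
pose f x : X := (psi x / `|y 0%N|) *: y 0%N.
have flin : linear f.
  by move=> a u v; rewrite /f lin mulrDl scalerDl -mulrA scalerA.
pose fM := GRing.isLinear.Build _ _ _ _ _ flin.
pose T : {linear X -> X} := HB.pack f fM.
have Ty : T (y 0%N) = y 0%N.
  rewrite /T/= /f nv; have [->|y0] := eqVneq (y 0%N) 0; first by rewrite scaler0.
  by rewrite divff ?scale1r// normr_eq0.
apply: (@complemented_closed_span _ _ y T 1) => [x|x|n a].
- rewrite mul1r /T/= /f normrZ normrM normfV normr_id.
  have [->|y0] := eqVneq (y 0%N) 0; first by rewrite normr0 mulr0.
  by rewrite divfK ?normr_eq0.
- rewrite -[T x]addr0; apply: closed_span_linear; first exact: closed_span_elt.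
  exact: closed_span0.
rewrite big1 ?normr0 ?mulr_ge0 ?invr_ge0// => i _.
by rewrite yE Ty subrr scaler0.
Qed.

(** Without convergence some subsequence keeps a fixed distance from [sigma]; [beta] is its limit
    along an ultrafilter. *)
Lemma bounded_cluster_point (R : realType) (S : nat -> R) (M sigma : R) :
  (forall n, `|S n| <= M) ->
  (forall eta : R, 0 < eta -> exists N, forall n, (N <= n)%N -> `|S n - sigma| < eta) \/
  exists2 beta, beta != sigma & forall N (eta : R), 0 < eta ->
    exists2 n, (N <= n)%N & `|S n - beta| < eta.
Proof.
move=> SM; have [?|H] := pselect (forall eta : R, 0 < eta ->
  exists N, forall n, (N <= n)%N -> `|S n - sigma| < eta); [by left|right].
have {H} [eta0 [eta0_gt0 Heta]] : exists eta0 : R, 0 < eta0 /\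
    forall N, exists n, (N <= n)%N /\ eta0 <= `|S n - sigma|.
  apply: contrapT => H'; apply: H => eta eta_gt0; apply: contrapT => HN.
  apply: H'; exists eta; split=> // N; apply: contrapT => Hn; apply: HN; exists N.
  move=> n Nn; rewrite ltNge; apply/negP => h; apply: Hn; exists n; split=> //.
have [g gP] := choice Heta.
have [U [UU sU]] := @ultraFilterLemma nat \oo _.
have UF := @ultra_proper _ _ UU.
have [beta bE] := ultra_cvg_bounded UU (fun k => SM (g k)).
have clus N (eta : R) : 0 < eta -> exists k, (N <= k)%N /\ `|S (g k) - beta| < eta.
  move=> eta_gt0; have /cvgrPdist_lt/(_ _ eta_gt0) H1 := bE.
  near U => k; exists k; split.
    by near: k; apply: sU; exact: nbhs_infty_ge.
  by rewrite distrC; near: k; exact: H1.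
exists beta => [|N eta eta_gt0].
  apply/eqP => bs; have [k [_]] := clus 0%N eta0 eta0_gt0.
  by rewrite bs ltNge (gP k).2.
have [k [Nk kb]] := clus N eta eta_gt0; exists (g k) => //.
exact: leq_trans Nk (gP k).1.
Unshelve. all: by end_near. Qed.

Theorem proposition4 (R : realType) (X Z : completeNormedModType R)
    (e : nat -> X) (z : nat -> Z)
    (he : conditional_spreading_basis e)
    (hz : convex_block_homogeneous_part e z)
    (y : nat -> X) (hy : equivalent_seq y z) :
  exists f : nat -> nat, increasing_seq f /\ complemented (closed_span (y \o f)).
Proof.
have [be _ Nue] := he; have [nrm [nrmE spr _ zE]] := hz.
have [nrmD nrmZ [k0 [k1 [k00 k10 k01]]]] := nrmE.
have [c [C [c0 C0 cC]]] := hy.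
have ci0 : 0 <= c^-1 by rewrite invr_ge0 ltW.
have yz (f : nat -> nat) n (a : nat -> R) :
    `|\sum_(i < n) a i *: y (f i)| <= c^-1 * `|\sum_(i < n) a i *: z (f i)|.
  apply: (@dominated_comp _ _ _ y z) => m d; rewrite ler_pdivlMl//.
  by case/andP: (cC m d).
have zy (f : nat -> nat) n (a : nat -> R) :
    `|\sum_(i < n) a i *: z (f i)| <= C * `|\sum_(i < n) a i *: y (f i)|.
  by apply: (@dominated_comp _ _ _ z y) => m d; case/andP: (cC m d).
have [z01|z01] := eqVneq (z 0%N) (z 1%N).
  exists id; split=> //; apply: complemented_constant => k /=.
  have := yz (fun i => if i is 0%N then k else 0%N) 2 (fun i => if i is 0%N then 1 else -1).
  rewrite !big_ord_recr !big_ord0/= !add0r !scale1r !scaleN1r.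
  rewrite (homogeneous_part_const nrmE spr zE z01 k) subrr normr0 mulr0 normr_le0.
  by rewrite subr_eq0 => /eqP.
have le_nrm x : `|x| <= k0^-1 * nrm x.
  by rewrite ler_pdivlMl//; case/andP: (k01 x).
have nrm_le x : nrm x <= k1 * `|x| by case/andP: (k01 x).
have k0i : 0 <= k0^-1 by rewrite invr_ge0 ltW.
have t0 := tail_const_gt0 z01.
have e00 := eqnorm_ge0 nrmE (e 0%N).
pose tc := tail_const z.
(* The factors [k0^-1] and [k1] carry the estimates for [nrm] over to the given norm. *)
pose K := k0^-1 * (1 + tc * nrm (e 0%N)) * k1.
have K0 : 0 <= K by rewrite !mulr_ge0 ?addr_ge0 ?mulr_ge0 ?(ltW t0) ?(ltW k10).
have eK p n (a : nat -> R) : (p <= n)%N ->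
    `|\sum_(i < p) a i *: e i| <= K * `|\sum_(i < n) a i *: e i|.
  move=> pn; apply: le_trans (le_nrm _) _; rewrite -2!mulrA ler_wpM2l//.
  apply: le_trans (eqnorm_partial_sum nrmE spr zE z01 a pn) _.
  by rewrite ler_wpM2l// addr_ge0 ?mulr_ge0 ?(ltW t0).
have eL p n (a : nat -> R) :
    `|\sum_(p <= i < n) a i| <= tc * k1 * `|\sum_(i < n) a i *: e i|.
  apply: le_trans (eqnorm_tail_le nrmE spr zE z01 p n a) _.
  by rewrite -mulrA ler_wpM2l// ltW.
have Le0 : 0 <= tc * k1 by rewrite mulr_ge0 ?(ltW t0) ?(ltW k10).
have yM k : `|y k| <= c^-1 * `|z 0%N|.
  have := yz (fun=> k) 1%N (fun=> 1); rewrite !big_ord1 !scale1r => /le_trans; apply.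
  rewrite ler_wpM2l//.
  have := @homogeneous_part_merge _ _ _ _ _ _ nrmE spr zE (fun=> k) 1 (fun=> 1) (fun _ _ _ => leqnn _).
  by rewrite !big_ord1 !scale1r.
pose L := tc * C; have L0 : 0 <= L by rewrite mulr_ge0 ?(ltW t0) ?(ltW C0).
have yL (f : nat -> nat) p n (a : nat -> R) : increasing_seq f ->
    `|\sum_(p <= i < n) a i| <= L * `|\sum_(i < n) a i *: y (f i)|.
  move=> fi; apply: le_trans (tail_le nrmE spr zE z01 p n a) _.
  rewrite -(homogeneous_part_spreading nrmE spr zE n a fi) /L -mulrA.
  by apply: ler_wpM2l; first exact: ltW.
have yC (k : nat -> nat) n (a : nat -> R) : {homo k : i j / (i <= j)%N} ->
    `|\sum_(i < n) a i *: y (k i)| <= c^-1 * k1 * `|\sum_(i < n) a i *: e i|.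
  move=> ki; apply: le_trans (yz k n a) _; rewrite -mulrA ler_wpM2l//.
  exact: le_trans (homogeneous_part_le nrmE spr zE n a ki) (nrm_le _).
have C1 : 0 <= c^-1 * k1 by rewrite mulr_ge0 ?(ltW k10).
have [b [sigma lim_b]] := exists_limit_coefficients be eK eL K0 Le0 yM.
have SM n : `|\sum_(i < n) b i| <= tc * k1 * (K * (c^-1 * `|z 0%N|)) + 1.
  have [s [_ _ H]] := lim_b; have [k [_ _ h _]] := H n 0%N 1 ltr01.
  have := eL 0%N n (coef be (y k)); rewrite big_mkord => h1.
  have h2 : tc * k1 * `|\sum_(i < n) coef be (y k) i *: e i| <=
      tc * k1 * (K * (c^-1 * `|z 0%N|)).
    rewrite ler_wpM2l//; apply: le_trans (partial_sum_le be eK n (y k)) _.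
    by rewrite ler_wpM2l.
  rewrite -[X in `|X|](subKr (\sum_(i < n) coef be (y k) i)).
  apply: le_trans (ler_normB _ _) _.
  by apply: lerD; [exact: le_trans h1 h2|exact: ltW].
have [sigmaE|[beta bs bcl]] := bounded_cluster_point sigma SM; last first.
  exact: (complemented_of_cluster_neq K0 L0 eK yM yL C1 yC Le0 lim_b bs bcl).
have ym (k f : nat -> nat) n (a : nat -> R) :
    {homo k : i j / (i <= j)%N} -> {homo f : i j / (i < j)%N} ->
    `|\sum_(i < n) a i *: y (k i)| <= c^-1 * C * `|\sum_(i < n) a i *: y (f i)|.
  move=> ki /increasing_seq_lt fi; apply: le_trans (yz k n a) _.
  rewrite -mulrA ler_wpM2l//.
  apply: le_trans (homogeneous_part_merge nrmE spr zE n a ki) _.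
  by rewrite -(homogeneous_part_spreading nrmE spr zE n a fi).
have yneq i j : (i < j)%N -> y i != y j.
  (* Along the increasing sequence i, j, j + 1, ... the tail functional from 1 takes the value -1 on
     [y i - y j], which therefore cannot vanish. *)
  move=> ij; apply/eqP => yij.
  have := yL (fun l => if l is l'.+1 then (j + l')%N else i) 1%N 2%N
    (fun l => if l is 0%N then 1 else -1).
  rewrite big_nat1 !big_ord_recr big_ord0/= add0r addn0 scale1r scaleN1r yij subrr.
  rewrite normr0 mulr0 normrN normr1 ler10; suff fi : increasing_seq
    (fun l => if l is l'.+1 then (j + l')%N else i) by move=> /(_ fi).
  apply: increasing_seq_lt => -[|l] [|l']//=; first by rewrite ltnS => _; exact: ltn_addr.
  by rewrite ltnS ltn_add2l.
pose Cs := k0^-1 * (k1 + nrm (e 0%N)).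
have Cs0 : 0 <= Cs by rewrite mulr_ge0// addr_ge0// ltW.
have scale_blocks (n : nat -> nat) (v : nat -> X) (t th : nat -> R) J :
    (forall j, (n j <= n j.+1)%N) -> (forall j, block e (n j) (n j.+1) (v j) (t j)) ->
    (forall j, 0 <= th j <= 1) ->
    `|\sum_(0 <= j < J) th j *: v j| <=
    Cs * (`|\sum_(0 <= j < J) v j| + \sum_(0 <= j < J) `|t j|).
  move=> nS vt th01; apply: le_trans (le_nrm _) _; rewrite -mulrA ler_wpM2l//.
  apply: le_trans (eqnorm_scale_blocks nrmE spr J nS vt th01) _.
  have T0 : 0 <= \sum_(0 <= j < J) `|t j| by exact: sumr_ge0.
  have := nrm_le (\sum_(0 <= j < J) v j).
  have := mulr_ge0 (ltW k10) T0.
  have := mulr_ge0 (normr_ge0 (\sum_(0 <= j < J) v j)) e00.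
  lra.
have small (eps : R) : 0 < eps -> exists (m : nat) (d : nat -> R),
    [/\ forall i, 0 <= d i, \sum_(i < m) d i = 1 &
      `|\sum_(i < m) d i *: (e i.*2 - e i.*2.+1)| < eps].
  move=> eps0; have [m [d [d0 d1 dl]]] :=
    conditional_small_differences nrmE spr be Nue (mulr_gt0 k00 eps0).
  exists m, d; split=> //; apply: le_lt_trans (le_nrm _) _.
  by rewrite ltr_pdivrMl.
apply: (complemented_of_cvg K0 L0 eK yM yL Cs0 C1 _ scale_blocks yC ym small yneq Le0 lim_b sigmaE).
by rewrite mulr_ge0// ltW.
Qed.
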